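(* Let $\{x_k,y_k\}_{k\ge0}$ be generated by $$x_{k+1}=x_k+\alpha_k\big(\tilde b_1^{(k+1)}-\tilde A_{11}^{(k+1)}x_k-\tilde A_{12}^{(k+1)}y_k\big),\qquad y_{k+1}=y_k+\beta_k\big(\tilde b_2^{(k+1)}-\tilde A_{21}^{(k+1)}x_k-\tilde A_{22}^{(k+1)}y_k\big),$$ and assume: (a) the matrix $-A_{11}$ is negative definite and the matrix $-\Delta$, where $\Delta=A_{22}-A_{21}A_{11}^{-1}A_{12}$, is (non-zero) negative semidefinite; (b) there exists a solution of the linear system $A_{11}x+A_{12}y=b_1$, $A_{21}x+A_{22}y=b_2$; (c) for $i,j\in\{1,2\}$ and all $k\ge0$, $\mathbb{E}[\tilde A_{ij}^{(k+1)}\mid\mathcal{F}_k]=A_{ij}$, $\mathbb{E}[\tilde b_i^{(k+1)}\mid\mathcal{F}_k]=b_i$, and moreover $\mathbb{E}[\|\tilde A_{ij}^{(k+1)}-A_{ij}\|^2\mid\mathcal{F}_k]\le\mathfrak{c}_3$ and $\mathbb{E}[\|\tilde b_i^{(k+1)}-b_i\|^2\mid\mathcal{F}_k]\le\mathfrak{c}_3$ for some constant $\mathfrak{c}_3$. Let $\alpha_k=\mathcal{O}\big(1/(k+1)^{0.5+0.66\epsilon}\big)$ and $\beta_k=\mathcal{O}\big(1/(k+1)^{0.75+\epsilon}\big)$, in the precise form specified in the context, where $\epsilon>0$ can be arbitrarily small. Then the iterates $\{x_k,y_k\}$ converge almost surely to the set of solutions of the linear system in (b), and $$\mathbb{E}\big[\|x_k-x^*(y_k)\|^2\big]\le\mathcal{O}\Big(\frac1{k^{0.5}}\Big),\qquad\mathbb{E}\big[\|A_{21}x_k+A_{22}y_k-b_2\|^2\big]\le\mathcal{O}\Big(\frac1{k^{0.25-\epsilon}}\Big),$$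 where $x^*(y)=A_{11}^{-1}(b_1-A_{12}y)$.
   Context: $x_k\in\mathbb{R}^{d_1}$, $y_k\in\mathbb{R}^{d_2}$, with initial iterates $x_0,y_0$; $A_{ij}\in\mathbb{R}^{d_i\times d_j}$ and $b_i\in\mathbb{R}^{d_i}$ are fixed, and $\tilde A_{ij}^{(k+1)}$, $\tilde b_i^{(k+1)}$ are random estimates of them obtained at time $k$. $\|\cdot\|$ is the Euclidean norm (for matrices, the induced operator norm). $\mathcal{F}_k=\sigma(x_0,y_0,M_i,M'_i,\ i\le k)$, where the noise terms are, up to positive constant factors, $M_{k+1}=\tilde b_1^{(k+1)}-b_1-(\tilde A_{11}^{(k+1)}-A_{11})x_k-(\tilde A_{12}^{(k+1)}-A_{12})y_k$ and $M'_{k+1}=\tilde b_2^{(k+1)}-b_2-(\tilde A_{21}^{(k+1)}-A_{21})x_k-(\tilde A_{22}^{(k+1)}-A_{22})y_k$. Step sizes: $\alpha_k=\alpha/(k+K_1)^{0.5+0.66\epsilon}$ and $\beta_k=\beta/(k+K_1)^{0.75+\epsilon}$ with constants $\alpha,\beta>0$ and $K_1\ge1$, and $0<\epsilon<1/4$ so that the exponent of $\beta_k$ is less than $1$. *)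

(* Defs.v *)
From HB Require Import structures.
From mathcomp Require Import all_boot all_order all_algebra.
From mathcomp Require Import all_classical all_reals all_analysis.
Import Order.TTheory GRing.Theory Num.Theory.
Import numFieldNormedType.Exports.

Set Implicit Arguments.
Unset Strict Implicit.
Unset Printing Implicit Defensive.

Local Open Scope classical_set_scope.
Local Open Scope ring_scope.

(* The library norm on matrices is the max norm, hence enorm and opnorm. *)
Definition enorm {R : realType} {n : nat} (v : 'cV[R]_n) : R :=
  Num.sqrt (\sum_(i < n) v i ord0 ^+ 2).

Definition opnorm {R : realType} {m n : nat} (A : 'M[R]_(m, n)) : R :=
  sup [set enorm (A *m v) | v in [set v : 'cV[R]_n | enorm v <= 1]].

(* Conditions on the quadratic form only: symmetry, where it is assumed, is a
   separate hypothesis. *)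
Definition negdefmx {R : realType} {n : nat} (A : 'M[R]_n) : Prop :=
  forall v : 'cV[R]_n, v != 0 -> (v^T *m A *m v) ord0 ord0 < 0.

Definition negsemidefmx {R : realType} {n : nat} (A : 'M[R]_n) : Prop :=
  forall v : 'cV[R]_n, (v^T *m A *m v) ord0 ord0 <= 0.

Definition schur {R : realType} {d1 d2 : nat}
    (A11 : 'M[R]_d1) (A12 : 'M[R]_(d1, d2))
    (A21 : 'M[R]_(d2, d1)) (A22 : 'M[R]_d2) : 'M[R]_d2 :=
  A22 - A21 *m invmx A11 *m A12.

Definition solutions {R : realType} {d1 d2 : nat}
    (A11 : 'M[R]_d1) (A12 : 'M[R]_(d1, d2))
    (A21 : 'M[R]_(d2, d1)) (A22 : 'M[R]_d2)
    (b1 : 'cV[R]_d1) (b2 : 'cV[R]_d2) : set ('cV[R]_d1 * 'cV[R]_d2) :=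
  [set z | A11 *m z.1 + A12 *m z.2 = b1 /\ A21 *m z.1 + A22 *m z.2 = b2].

(* Euclidean distance in R^(d1 + d2) from (x, y) to S, for S nonempty. *)
Definition dist_set {R : realType} {d1 d2 : nat}
    (S : set ('cV[R]_d1 * 'cV[R]_d2)) (x : 'cV[R]_d1) (y : 'cV[R]_d2) : R :=
  inf [set Num.sqrt (enorm (x - z.1) ^+ 2 + enorm (y - z.2) ^+ 2) | z in S].

Definition stepsize {R : realType} (c K e : R) (k : nat) : R :=
  c / (k%:R + K) `^ e.

(* Y is a version of E[X | F], for F a sub-sigma-algebra of the measurable
   sets. *)
Definition cond_exp {R : realType} {d : measure_display} {T : measurableType d}
    (P : probability T R) (F : set (set T)) (X Y : T -> R) : Prop :=
  [/\ P.-integrable setT (EFin \o X),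
      P.-integrable setT (EFin \o Y),
      forall B : set R, measurable B -> F (Y @^-1` B) &
      forall G : set T, F G ->
        (\int[P]_(w in G) (X w)%:E = \int[P]_(w in G) (Y w)%:E)%E].

(* E[X | F] = mu entrywise, and E[nrm (X - mu)^2 | F] <= c almost surely. *)
Definition unbiased_bounded {R : realType} {d : measure_display}
    {T : measurableType d} (P : probability T R) (F : set (set T)) {m n : nat}
    (nrm : 'M[R]_(m, n) -> R) (c : R)
    (X : T -> 'M[R]_(m, n)) (mu : 'M[R]_(m, n)) : Prop :=
  (forall i j, cond_exp P F (fun w => X w i j) (cst (mu i j))) /\
  (exists Z : T -> R,
     cond_exp P F (fun w => nrm (X w - mu) ^+ 2) Z /\
     {ae P, forall w, Z w <= c}).

(* With p := k this is the noise term of index k + 1: the estimates carry the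
   index k + 1, the iterates the index k. *)
Definition noise {R : realType} {T : Type} {m d1 d2 : nat}
    (b : 'cV[R]_m) (A1 : 'M[R]_(m, d1)) (A2 : 'M[R]_(m, d2))
    (tb : nat -> T -> 'cV[R]_m)
    (tA1 : nat -> T -> 'M[R]_(m, d1)) (tA2 : nat -> T -> 'M[R]_(m, d2))
    (x : nat -> T -> 'cV[R]_d1) (y : nat -> T -> 'cV[R]_d2)
    (p : nat) (w : T) : 'cV[R]_m :=
  tb p.+1 w - b - (tA1 p.+1 w - A1) *m x p w - (tA2 p.+1 w - A2) *m y p w.

Definition coord_preimages {R : realType} {T : Type} {n : nat}
    (X : T -> 'cV[R]_n) : set (set T) :=
  \bigcup_(j in [set: 'I_n])
    preimage_set_system setT (fun w => X w j ord0) (@measurable _ R).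

(* sigma(x0, y0, M_1, M'_1, ..., M_k, M'_k), where M_(p+1) = N p and
   M'_(p+1) = N' p. *)
Definition filtration {R : realType} {T : Type} {d1 d2 : nat}
    (x0 : T -> 'cV[R]_d1) (y0 : T -> 'cV[R]_d2)
    (N : nat -> T -> 'cV[R]_d1) (N' : nat -> T -> 'cV[R]_d2)
    (k : nat) : set (set T) :=
  <<s coord_preimages x0 `|` coord_preimages y0 `|`
      \bigcup_(p in [set p : nat | (p < k)%N])
        (coord_preimages (N p) `|` coord_preimages (N' p)) >>.

Definition square_integrable {R : realType} {d : measure_display}
    {T : measurableType d} (P : probability T R) {n : nat}
    (X : T -> 'cV[R]_n) : Prop :=
  (forall j, measurable_fun setT (fun w => X w j ord0)) /\
  ('E_P[fun w => (enorm (X w) ^+ 2)%R] < +oo)%E.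

(* Main.v *)
(** Let y^* be the second component of a solution, B = A11^-1 A12,
    z_k = x_k - x^*(y_k) and u_k = y_k - y^*; then A11 x + A12 y - b1 = A11 z
    and A21 x + A22 y - b2 = A21 z + Delta u.  Write n = k + K1, Z = |z|^2,
    U = |u|^2, Q = u^T Delta u.  One step of the iteration gives, in
    conditional expectation and with alpha^2, beta^2 / alpha = O(n^-(1+eps)),

      Z' <= (1 - c alpha) Z + O(n^-(1+eps)) (1 + Z + U),
      U' <= U + c alpha Z + O(n^-(1+eps)) (1 + Z + U),
      Q' <= (1 - c' beta) Q + O(beta) Z + O(beta^2) (1 + Z + U),

    the last one because a positive semidefinite form satisfies
    u^T Delta u <= K |Delta u|^2.  Adding the first two lines, E[Z + U] stays
    bounded; the first then gives E[Z] = O(n^-1/2), and the third gives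
    E[Q] = O(n^-1/2), which is better than what is claimed.  Finally Z + Q is
    a supermartingale up to summable errors and tends to 0 in mean, so that the
    maximal inequality yields Z + Q -> 0 almost surely, and the squared
    distance to the set of solutions is at most a constant times Z + Q. *)
Require Import Defs.
From HB Require Import structures.
From mathcomp Require Import all_boot all_order all_algebra.
From mathcomp Require Import all_classical all_reals all_analysis.
From mathcomp Require Import measurable_realfun.
From mathcomp Require Import ring lra.
Import Order.TTheory GRing.Theory Num.Theory.
Import numFieldNormedType.Exports.

Set Implicit Arguments.
Unset Strict Implicit.
Unset Printing Implicit Defensive.

Local Open Scope classical_set_scope.
Local Open Scope ring_scope.

(** * Euclidean inner product and quadratic forms *)

(** The noise multiplies the iterates, so its conditional variance is only bounded by a multiple of
    1 + Z + U. Since Delta may be singular, U is not contracted either: it is carried along only to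
    be kept bounded, and progress in y is measured by Q. The term beta^2 / alpha is the price of the
    drift of x^*(y_k): Young's inequality absorbs the resulting cross term in half of the
    contraction of Z. The exponents give alpha^2 = O(n^-(1 + 1.32 eps)) and beta^2 / alpha = O(n^-(1
    + 1.34 eps)), which explains the factor 0.66. Conditional expectations are replaced throughout
    by integrals over arbitrary sets of the sigma-algebra. In the almost sure part Z and U are
    controlled only in mean, so the errors are deterministic amounts added to these integrals, not
    scaled by the probability of the set; the maximal inequality is arranged to spend each of them
    once. *)

Definition dot {R : pzRingType} {n : nat} (u v : 'cV[R]_n) : R :=
  (u^T *m v) ord0 ord0.

Section dot_theory.
Variables (R : realFieldType).
Implicit Types n m : nat.

Lemma dotE n (u v : 'cV[R]_n) : dot u v = \sum_i u i ord0 * v i ord0.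
Proof. by rewrite /dot mxE; apply: eq_bigr => i _; rewrite mxE. Qed.

Lemma dotC n (u v : 'cV[R]_n) : dot u v = dot v u.
Proof. by rewrite !dotE; apply: eq_bigr => i _; rewrite mulrC. Qed.

Lemma dotDl n (u v w : 'cV[R]_n) : dot (u + v) w = dot u w + dot v w.
Proof. by rewrite /dot linearD mulmxDl mxE. Qed.

Lemma dotZl n a (u w : 'cV[R]_n) : dot (a *: u) w = a * dot u w.
Proof. by rewrite /dot linearZ -scalemxAl mxE. Qed.

Lemma dotNl n (u w : 'cV[R]_n) : dot (- u) w = - dot u w.
Proof. by rewrite -scaleN1r dotZl mulN1r. Qed.

Lemma dotDr n (u v w : 'cV[R]_n) : dot w (u + v) = dot w u + dot w v.
Proof. by rewrite dotC dotDl !(dotC w). Qed.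

Lemma dotZr n a (u w : 'cV[R]_n) : dot w (a *: u) = a * dot w u.
Proof. by rewrite dotC dotZl (dotC w). Qed.

Lemma dotNr n (u w : 'cV[R]_n) : dot w (- u) = - dot w u.
Proof. by rewrite dotC dotNl (dotC w). Qed.

Definition dotL := (dotDl, dotDr, dotZl, dotZr, dotNl, dotNr).

Lemma dot_mulmxr n m (A : 'M[R]_(n, m)) (u : 'cV_n) (v : 'cV_m) :
  dot u (A *m v) = dot (A^T *m u) v.
Proof. by rewrite /dot mulmxA trmx_mul trmxK. Qed.

Lemma dot_ge0 n (u : 'cV[R]_n) : 0 <= dot u u.
Proof. by rewrite dotE sumr_ge0 // => i _; rewrite -expr2 sqr_ge0. Qed.

Lemma dot_eq0 n (u : 'cV[R]_n) : (dot u u == 0) = (u == 0).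
Proof.
apply/idP/eqP => [|->]; last by rewrite /dot mulmx0 mxE.
rewrite dotE psumr_eq0 => [/allP u0|i _]; last by rewrite -expr2 sqr_ge0.
apply/colP => i; rewrite mxE; apply/eqP.
by have := u0 i (mem_index_enum i); rewrite mulf_eq0 orbb.
Qed.

Lemma dot_entry_le n (u : 'cV[R]_n) i : u i ord0 ^+ 2 <= dot u u.
Proof.
rewrite dotE (bigD1 i) //= -expr2 lerDl sumr_ge0 // => j _.
by rewrite -expr2 sqr_ge0.
Qed.

(** Expand |t u - v|^2 >= 0 and divide by t. The free weight t decides which of the two squares is
    made small. *)
Lemma dot_young n t (u v : 'cV[R]_n) : 0 < t ->
  2 * dot u v <= t * dot u u + t^-1 * dot v v.
Proof.
move=> t0; have := dot_ge0 (t *: u - v).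
rewrite !dotL (dotC v u) => h.
rewrite -subr_ge0; have -> : t * dot u u + t^-1 * dot v v - 2 * dot u v =
    t^-1 * (t * (t * dot u u) + - (t * dot u v) + (- (t * dot u v) - - dot v v)).
  by field; rewrite gt_eqF.
by rewrite mulr_ge0 ?invr_ge0 ?(ltW t0) //; lra.
Qed.

Lemma dotD_le n (u v : 'cV[R]_n) :
  dot (u + v) (u + v) <= 2 * dot u u + 2 * dot v v.
Proof.
have := @dot_young _ 1 u v ltr01.
by rewrite invr1 !mul1r !dotL (dotC v u); lra.
Qed.

(** Up to the factor |u|^2, the difference of the two sides is the squared norm of |u|^2 v - (u.v)
    u, which is u-orthogonal. *)
Lemma dot_cauchy_schwarz n (u v : 'cV[R]_n) :
  dot u v ^+ 2 <= dot u u * dot v v.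
Proof.
have [->|u0] := eqVneq u 0; first by rewrite /dot trmx0 !mul0mx !mxE mul0r expr0n.
have uu : 0 < dot u u by rewrite lt_neqAle dot_ge0 eq_sym dot_eq0 u0.
have := dot_ge0 (dot u u *: v - dot u v *: u).
rewrite !dotL (dotC v u) -(pmulr_rge0 _ uu) => h.
have : 0 <= dot u u ^+ 2 * (dot u u * dot v v - dot u v ^+ 2) by lra.
by rewrite pmulr_rge0 ?exprn_gt0 // subr_ge0.
Qed.

(** Cauchy-Schwarz row by row; the constant is the squared Frobenius norm, plus 1 so that it can be
    divided by. *)
Lemma mulmx_bound n m (A : 'M[R]_(m, n)) :
  exists2 C, 0 < C & forall v : 'cV_n, dot (A *m v) (A *m v) <= C * dot v v.
Proof.
pose S := \sum_i dot (row i A)^T (row i A)^T.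
have S0 : 0 <= S by rewrite sumr_ge0 // => i _; rewrite dot_ge0.
exists (1 + S); first by lra.
move=> v; apply: (@le_trans _ _ (S * dot v v)); last first.
  by have := dot_ge0 v; nra.
rewrite {1}dotE mulr_suml; apply: ler_sum => i _.
have -> : (A *m v) i ord0 = dot (row i A)^T v.
  by rewrite /dot trmxK -row_mul [RHS]mxE.
by rewrite -expr2 dot_cauchy_schwarz.
Qed.

(** A row r with r A = 0 makes the form vanish at r^T, so the left kernel is trivial. *)
Lemma posdefmx_unit n (A : 'M[R]_n) :
  (forall v : 'cV_n, v != 0 -> 0 < dot v (A *m v)) -> A \in unitmx.
Proof.
move=> A0; rewrite -row_free_unit -kermx_eq0; apply/eqP/row_matrixP => i.
rewrite row0; set r := row i _.
have rA : r *m A = 0 by apply: sub_kermxP; rewrite row_sub.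
apply/eqP; apply: contraT => r0.
have := A0 r^T; rewrite trmx_eq0 r0 => /(_ isT).
by rewrite dot_mulmxr -trmx_mul rA /dot !trmx0 mul0mx mxE ltxx.
Qed.

(* Completing the square: with [S] the symmetric part of [A], expand
   [(v - t S^-1 v)^T S (v - t S^-1 v) >= 0] at [t = 1 / C], where
   [v^T S^-1 v <= C v^T v]. *)
Lemma posdefmx_coercive n (A : 'M[R]_n) :
  (forall v : 'cV_n, v != 0 -> 0 < dot v (A *m v)) ->
  exists2 c, 0 < c & forall v : 'cV_n, c * dot v v <= dot v (A *m v).
Proof.
move=> A0; pose S := A + A^T.
have SE (v : 'cV_n) : dot v (S *m v) = 2 * dot v (A *m v).
  rewrite /S mulmxDl dotDr (dot_mulmxr A^T) trmxK (dotC (A *m v)); ring.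
have Spos (v : 'cV_n) : 0 <= dot v (S *m v).
  have [->|v0] := eqVneq v 0; first by rewrite /dot trmx0 mul0mx mxE.
  by rewrite SE mulr_ge0 // ltW // A0.
have Sunit : S \in unitmx.
  by apply: posdefmx_unit => v v0; rewrite SE mulr_gt0 // A0.
have Ssym : S^T = S by rewrite /S linearD /= trmxK addrC.
have [C C0 hC] := mulmx_bound (invmx S).
have hS (v : 'cV_n) : dot v (invmx S *m v) <= (1 + C) * dot v v.
  have := @dot_young _ 1 v (invmx S *m v) ltr01.
  have := hC v; have := dot_ge0 v; have := dot_ge0 (invmx S *m v).
  by rewrite invr1 !mul1r; lra.
exists ((1 + C)^-1 / 2); first by rewrite divr_gt0 // invr_gt0; lra.
move=> v; have := Spos (v - (1 + C)^-1 *: (invmx S *m v)).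
rewrite mulmxBr -scalemxAr (mulKVmx Sunit) !dotL (dot_mulmxr S (invmx S *m v)).
rewrite Ssym (mulKVmx Sunit) (dotC (invmx S *m v)).
rewrite SE; have := hS v; set t := (1 + C)^-1 => hv.
have t0 : 0 < t by rewrite invr_gt0; lra.
have tC : t * (1 + C) = 1 by rewrite mulVf // gt_eqF // addr_gt0.
have : t * (t * dot v (invmx S *m v)) <= t * dot v v.
  rewrite ler_pM2l // -(mul1r (dot v v)) -tC -mulrA ler_pM2l //.
by lra.
Qed.

(** * Possibly degenerate positive semidefinite forms *)

Section psd.
Variables (n : nat) (D : 'M[R]_n).
Hypothesis Dsym : D^T = D.
Hypothesis Dpsd : forall v : 'cV_n, 0 <= dot v (D *m v).

(** Because A A^+ A = A. The correction [pinvmx A *m (A *m u)] is bounded by a multiple of |A u|, so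
    this places u at distance O(|A u|) from the kernel. *)
Lemma mulmx_near_kernel m (A : 'M[R]_(m, n)) (u : 'cV_n) :
  A *m (u - pinvmx A *m (A *m u)) = 0.
Proof. by rewrite mulmxBr (mulmxA A) (mulmxA (A *m pinvmx A)) mulmxKpV ?subrr. Qed.

(** By symmetry the form does not see the kernel component of u, so u may be replaced by
    [pinvmx D *m (D *m u)], whose norm is O(|D u|). This is what makes Q contract although D may be
    singular. *)
Lemma psd_form_le : exists2 C, 0 < C &
  forall u : 'cV_n, dot u (D *m u) <= C * dot (D *m u) (D *m u).
Proof.
have [C C0 hC] := mulmx_bound (pinvmx D).
exists (1 + C); first by lra.
move=> u; set g := D *m u.
have -> : dot u g = dot (pinvmx D *m g) g.
  apply/eqP; rewrite -subr_eq0 -dotNl -dotDl {2}/g dot_mulmxr Dsym.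
  by rewrite /g mulmx_near_kernel /dot trmx0 mul0mx mxE.
have := @dot_young _ 1 (pinvmx D *m g) g ltr01.
have := hC g; have := dot_ge0 g; have := dot_ge0 (pinvmx D *m g).
by rewrite invr1 !mul1r; lra.
Qed.

(* Expand [(u - t D u)^T D (u - t D u) >= 0] at [t = 1 / C], where
   [w^T D w <= C w^T w]. *)
Lemma psd_form_ge : exists2 C, 0 < C &
  forall u : 'cV_n, dot (D *m u) (D *m u) <= C * dot u (D *m u).
Proof.
have [C C0 hC] := mulmx_bound D.
exists (1 + C); first by lra.
move=> u; set g := D *m u.
have hg : dot g (D *m g) <= (1 + C) * dot g g.
  have := @dot_young _ 1 g (D *m g) ltr01.
  have := hC g; have := dot_ge0 g; have := dot_ge0 (D *m g).
  by rewrite invr1 !mul1r; lra.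
have := Dpsd (u - (1 + C)^-1 *: g).
rewrite mulmxBr -scalemxAr -/g !dotL (dot_mulmxr D u g) Dsym -/g.
move: hg; set t := (1 + C)^-1 => hg.
have t0 : 0 < t by rewrite invr_gt0; lra.
have tC : t * (1 + C) = 1 by rewrite mulVf // gt_eqF // addr_gt0.
have h : t * (t * dot g (D *m g)) <= t * dot g g.
  rewrite ler_pM2l // -(mul1r (dot g g)) -tC -mulrA ler_pM2l //.
move=> hpos; have -> : dot g g = (1 + C) * (t * dot g g).
  by rewrite mulrA (mulrC (1 + C)) tC mul1r.
rewrite ler_pM2l; last by lra.
by lra.
Qed.

End psd.

(** * One-step inequalities for the noiseless iteration *)

Lemma dot_mulmxD_bound n m p (E : 'M[R]_(p, n)) (F : 'M[R]_(p, m)) :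
  exists2 K, 0 < K & forall (z : 'cV_n) (u : 'cV_m),
    dot (E *m z + F *m u) (E *m z + F *m u) <= K * (dot z z + dot u u).
Proof.
have [CE CE0 hE] := mulmx_bound E; have [CF CF0 hF] := mulmx_bound F.
exists (2 * (CE + CF)); first by lra.
move=> z u; have := dotD_le (E *m z) (F *m u).
have := hE z; have := hF u.
have := mulr_ge0 (ltW CE0) (dot_ge0 u); have := mulr_ge0 (ltW CF0) (dot_ge0 z).
lra.
Qed.

(** Coercivity contracts |z|^2 by 2 c a. The cross term in b is split by Young with weight c a: this
    gives back half of the contraction and leaves a remainder of order b^2 / a. *)
Lemma fast_step_bound n m (A E : 'M[R]_n) (F : 'M[R]_(n, m)) c : 0 < c ->
  (forall v : 'cV_n, c * dot v v <= dot v (A *m v)) ->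
  exists2 C, 0 < C & forall (a b : R) (z w : 'cV_n) (u : 'cV_m), 0 < a ->
    w = z - a *: (A *m z) - b *: (E *m z + F *m u) ->
    dot w w <= (1 - c * a) * dot z z
      + C * (a ^+ 2 + b ^+ 2 / a + b ^+ 2) * (dot z z + dot u u).
Proof.
move=> c0 hA; have [CA CA0 hCA] := mulmx_bound A.
have [K K0 hK] := dot_mulmxD_bound E F.
exists (2 * CA + c^-1 * K + 2 * K).
  by rewrite !addr_gt0 ?mulr_gt0 ?invr_gt0.
move=> a b z w u a0; move: (hK z u); move: (E *m z + F *m u) => g hg wE.
have -> : dot w w = dot z z - 2 * a * dot z (A *m z) - 2 * dot z (b *: g)
                    + dot (a *: (A *m z) + b *: g) (a *: (A *m z) + b *: g).
  rewrite wE !dotL (dotC g z) (dotC (A *m z) z) (dotC g (A *m z)); ring.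
have hb : - (2 * dot z (b *: g)) <= c * a * dot z z + (c * a)^-1 * (b ^+ 2 * dot g g).
  have := @dot_young _ (c * a) (- z) (b *: g) (mulr_gt0 c0 a0).
  by rewrite !dotL; move: (c * a)^-1 => t; lra.
have hw := dotD_le (a *: (A *m z)) (b *: g); rewrite !dotZl !dotZr in hw.
have h1 : 2 * a * (c * dot z z) <= 2 * a * dot z (A *m z).
  by rewrite ler_pM2l ?mulr_gt0.
have h2 : a ^+ 2 * dot (A *m z) (A *m z) <= CA * a ^+ 2 * (dot z z + dot u u).
  rewrite (mulrC CA) -(mulrA (a ^+ 2)) ler_pM2l ?exprn_gt0 // mulrDr.
  by rewrite ler_wpDr // mulr_ge0 ?dot_ge0 ?ltW.
have h3 : b ^+ 2 * dot g g <= b ^+ 2 * (K * (dot z z + dot u u)).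
  by rewrite ler_wpM2l ?sqr_ge0.
have h4 : (c * a)^-1 * (b ^+ 2 * dot g g) <=
          c^-1 * K * (b ^+ 2 / a) * (dot z z + dot u u).
  have -> : c^-1 * K * (b ^+ 2 / a) * (dot z z + dot u u) =
            (c * a)^-1 * (b ^+ 2 * (K * (dot z z + dot u u))).
    by field; rewrite !gt_eqF.
  by rewrite ler_pM2l // invr_gt0 mulr_gt0.
set q := b ^+ 2 / a in h4 *.
have q0 : 0 <= q by rewrite divr_ge0 ?sqr_ge0 ?ltW.
have s0 : 0 <= dot z z + dot u u by rewrite addr_ge0 ?dot_ge0.
set s := dot z z + dot u u in h2 h3 h4 s0 *.
(* Multiplied out, the claimed error contains the bounds [h2] and [h4] and part of [h3] with their
   multiplicities; everything else is nonnegative by [e2]. *)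
have e1 : (2 * CA + c^-1 * K + 2 * K) * (a ^+ 2 + q + b ^+ 2) * s =
  2 * (CA * a ^+ 2 * s) + c^-1 * K * q * s + 2 * (b ^+ 2 * (K * s))
  + (2 * CA * (q + b ^+ 2) + c^-1 * K * (a ^+ 2 + b ^+ 2) + 2 * K * (a ^+ 2 + q)) * s.
  by ring.
have e2 : 0 <= (2 * CA * (q + b ^+ 2) + c^-1 * K * (a ^+ 2 + b ^+ 2)
    + 2 * K * (a ^+ 2 + q)) * s.
  have a2 := sqr_ge0 a; have b2 := sqr_ge0 b.
  have [CA' K'] := (ltW CA0, ltW K0).
  have c' : 0 <= c^-1 by rewrite invr_ge0 ltW.
  by rewrite mulr_ge0 // !addr_ge0 // mulr_ge0 ?addr_ge0 // mulr_ge0.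
rewrite e1; lra.
Qed.

(** The form of D has a good sign and is dropped. The Young weight is tuned so that the cross term
    costs exactly [c * a * dot z z], where c is free: with the coercivity constant of the fast step,
    this term cancels against the contraction there. *)
Lemma slow_step_bound n m (E : 'M[R]_(m, n)) (D : 'M[R]_m) c : 0 < c ->
  (forall v : 'cV_m, 0 <= dot v (D *m v)) ->
  exists2 C, 0 < C & forall (a b : R) (z : 'cV_n) (u w : 'cV_m), 0 < a -> 0 <= b ->
    w = u - b *: (E *m z + D *m u) ->
    dot w w <= dot u u + c * a * dot z z
      + C * (b ^+ 2 / a + b ^+ 2) * (dot z z + dot u u).
Proof.
move=> c0 hD; have [CE CE0 hCE] := mulmx_bound E.
have [K K0 hK] := dot_mulmxD_bound E D.
exists (CE / c + K); first by rewrite addr_gt0 ?divr_gt0.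
move=> a b z u w a0 b0; move: (hK z u); move gE : (E *m z + D *m u) => g hg wE.
have -> : dot w w = dot u u - 2 * b * dot u (D *m u) - 2 * dot (E *m z) (b *: u)
                    + b ^+ 2 * dot g g.
  rewrite wE !dotL (dotC g u) -gE !dotL (dotC (E *m z) u); ring.
have t0 : 0 < c * a / CE by rewrite divr_gt0 ?mulr_gt0.
have hb : - (2 * dot (E *m z) (b *: u)) <=
    c * a / CE * dot (E *m z) (E *m z) + (c * a / CE)^-1 * (b ^+ 2 * dot u u).
  have := @dot_young _ _ (- (E *m z)) (b *: u) t0.
  by rewrite !dotL; move: (c * a / CE)^-1 => t; lra.
have h1 : c * a / CE * dot (E *m z) (E *m z) <= c * a * dot z z.
  have -> : c * a * dot z z = c * a / CE * (CE * dot z z) by field; rewrite gt_eqF.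
  by rewrite ler_pM2l.
have s0 : dot u u <= dot z z + dot u u by rewrite lerDr dot_ge0.
have h2 : (c * a / CE)^-1 * (b ^+ 2 * dot u u) <=
    CE / c * (b ^+ 2 / a) * (dot z z + dot u u).
  have -> : CE / c * (b ^+ 2 / a) * (dot z z + dot u u) =
            (c * a / CE)^-1 * (b ^+ 2 * (dot z z + dot u u)).
    by field; rewrite !gt_eqF.
  by rewrite ler_pM2l ?invr_gt0 // ler_wpM2l ?sqr_ge0.
have h3 : b ^+ 2 * dot g g <= b ^+ 2 * (K * (dot z z + dot u u)).
  by rewrite ler_wpM2l ?sqr_ge0.
have h4 : 0 <= b * dot u (D *m u) by rewrite mulr_ge0.
set q := b ^+ 2 / a in h2 *.
have q0 : 0 <= q by rewrite divr_ge0 ?sqr_ge0 ?ltW.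
set s := dot z z + dot u u in h2 h3 s0 *.
have s1 : 0 <= s by rewrite (le_trans _ s0) ?dot_ge0.
have e1 : (CE / c + K) * (q + b ^+ 2) * s =
  CE / c * q * s + b ^+ 2 * (K * s) + (CE / c * b ^+ 2 + K * q) * s.
  by ring.
have e2 : 0 <= (CE / c * b ^+ 2 + K * q) * s.
  have b2 := sqr_ge0 b; have [CE' c'] := (ltW CE0, ltW c0).
  by rewrite mulr_ge0 // addr_ge0 // mulr_ge0 ?divr_ge0 // ltW.
rewrite e1; lra.
Qed.

(** Symmetry makes 2 D u the gradient of the form, so a step along - D u gains 2 b |D u|^2. One half
    pays for the cross term with E z, the other half dominates c b times the form. *)
Lemma form_step_bound n m (E : 'M[R]_(m, n)) (D : 'M[R]_m) c : 0 < c ->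
  D^T = D ->
  (forall v : 'cV_m, c * dot v (D *m v) <= dot (D *m v) (D *m v)) ->
  exists2 C, 0 < C & forall (b : R) (z : 'cV_n) (u w : 'cV_m), 0 <= b ->
    w = u - b *: (E *m z + D *m u) ->
    dot w (D *m w) <= (1 - c * b) * dot u (D *m u) + C * b * dot z z
      + C * b ^+ 2 * (dot z z + dot u u).
Proof.
move=> c0 Dsym hD; have [CE CE0 hCE] := mulmx_bound E.
have [CD CD0 hCD] := mulmx_bound D.
have [K K0 hK] := dot_mulmxD_bound E D.
exists (CE + (1 + CD) * K); first by rewrite addr_gt0 ?mulr_gt0; lra.
move=> b z u w b0; move: (hK z u); move gE : (E *m z + D *m u) => g hg wE.
have -> : dot w (D *m w) = dot u (D *m u) - 2 * b * dot (D *m u) (D *m u)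
    - b * (2 * dot (E *m z) (D *m u)) + b ^+ 2 * dot g (D *m g).
  rewrite wE mulmxBr -scalemxAr !dotL (dot_mulmxr D u g) Dsym -gE !dotL.
  rewrite (dotC (D *m u) (E *m z)); ring.
have h1 : b * - (2 * dot (E *m z) (D *m u)) <=
    b * (dot (E *m z) (E *m z) + dot (D *m u) (D *m u)).
  rewrite ler_wpM2l //; have := @dot_young _ 1 (- (E *m z)) (D *m u) ltr01.
  by rewrite !dotL invr1; lra.
have h2 : dot g (D *m g) <= (1 + CD) * (K * (dot z z + dot u u)).
  have := @dot_young _ 1 g (D *m g) ltr01.
  have := hCD g; have := dot_ge0 g; have := dot_ge0 (D *m g).
  rewrite invr1 !mul1r => p1 p2 p3 p4.
  have : (1 + CD) * dot g g <= (1 + CD) * (K * (dot z z + dot u u)).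
    by rewrite ler_pM2l //; lra.
  lra.
have h3 : b ^+ 2 * dot g (D *m g) <= b ^+ 2 * ((1 + CD) * (K * (dot z z + dot u u))).
  by rewrite ler_wpM2l ?sqr_ge0.
have h4 : b * (c * dot u (D *m u)) <= b * dot (D *m u) (D *m u).
  by rewrite ler_wpM2l.
have h5 : b * dot (E *m z) (E *m z) <= b * (CE * dot z z) by rewrite ler_wpM2l.
set s := dot z z + dot u u in h3 *.
have s1 : 0 <= s by rewrite addr_ge0 ?dot_ge0.
have e0 : (CE + (1 + CD) * K) * b * dot z z + (CE + (1 + CD) * K) * b ^+ 2 * s =
  b * (CE * dot z z) + b ^+ 2 * ((1 + CD) * (K * s)) +
  (1 + CD) * K * b * dot z z + CE * b ^+ 2 * s by ring.
have e1 : 0 <= (1 + CD) * K * b * dot z z by rewrite !mulr_ge0 ?dot_ge0 //; lra.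
have e2 : 0 <= CE * b ^+ 2 * s by rewrite !mulr_ge0 ?sqr_ge0 //; lra.
by rewrite -[leRHS]addrA e0; lra.
Qed.

End dot_theory.

(** * Real recursions *)

Section real_sequences.
Variable R : realType.
Implicit Types (x c p K e : R) (k n : nat).

Lemma powRN_le x p q : 1 <= x -> q <= p -> x `^ (- p) <= x `^ (- q).
Proof. by move=> x1 qp; rewrite ler_powR // lerN2. Qed.

Lemma powRN_addE x p q : 1 <= x -> x `^ (- (p + q)) = x `^ (- p) * x `^ (- q).
Proof.
move=> x1; have x0 : x != 0 by rewrite gt_eqF // (lt_le_trans ltr01).
by rewrite opprD powRD // x0 implybT.
Qed.

(* The increments of [-x^-e], up to the factor [4 / e], dominate [x^-(1+e)]:
   this makes the step-size errors telescope. *)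
Lemma powRN_telescope x e : 1 <= x -> 0 < e -> e <= 1 ->
  x `^ (- (1 + e)) <= 4 / e * (x `^ (- e) - (x + 1) `^ (- e)).
Proof.
move=> x1 e0 e1; have x0 : 0 < x by lra.
have x0' : x != 0 by rewrite gt_eqF.
(* Since x + 1 <= 2 x, y is at most e / (x + 1) <= e ln ((x + 1) / x), whence ((x + 1) / x)^e >= 1 +
   y. The factor 4 / e comes from y / 2 = e / (4 x). *)
pose y := e / (2 * x).
have y0 : 0 < y by rewrite divr_gt0 // mulr_gt0.
have y1 : y <= 1 by rewrite ler_pdivrMr ?mulr_gt0 //; lra.
have ln1x : (x + 1)^-1 <= ln ((x + 1) / x).
  have := @le_ln1Dx R (- (x + 1)^-1).
  have -> : 1 + - (x + 1)^-1 = x / (x + 1) by field; lra.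
  rewrite -(invf_div (x + 1) x) lnV ?posrE ?divr_gt0 //; last by lra.
  rewrite lerN2; apply; rewrite ltrN2 invf_lt1; lra.
have hx : x `^ e * (1 + y) <= (x + 1) `^ e.
  have -> : (x + 1) `^ e = x `^ e * ((x + 1) / x) `^ e.
    rewrite -powRM ?divr_ge0 //; try lra.
    by congr (_ `^ _); field.
  rewrite ler_pM2l ?powR_gt0 //.
  rewrite /powR gt_eqF ?divr_gt0 //; last by lra.
  apply: le_trans (expR_ge1Dx _); rewrite lerD2l.
  apply: (@le_trans _ _ (e * (x + 1)^-1)); last by rewrite ler_pM2l.
  rewrite /y ler_pM2l // lef_pV2 ?posrE; lra.
have hN : (x + 1) `^ (- e) <= x `^ (- e) * (1 + y)^-1.
  rewrite !powRN -invfM lef_pV2 // posrE ?powR_gt0 ?mulr_gt0 ?powR_gt0 //; lra.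
have hy : 1 - (1 + y)^-1 >= y / 2.
  have -> : 1 - (1 + y)^-1 = y / (1 + y) by field; lra.
  by rewrite ler_pM2l // lef_pV2 ?posrE; lra.
rewrite powRN_addE // powR_inv1 ?(ltW x0) //.
have p0 : 0 < x `^ (- e) by rewrite powR_gt0.
apply: (@le_trans _ _ (4 / e * (x `^ (- e) * (y / 2)))).
  have -> // : 4 / e * (x `^ (- e) * (y / 2)) = x^-1 * x `^ (- e).
  by rewrite /y; field; rewrite x0' gt_eqF.
rewrite ler_pM2l ?divr_gt0 //.
have : x `^ (- e) * (y / 2) <= x `^ (- e) * (1 - (1 + y)^-1) by rewrite ler_pM2l.
by rewrite mulrBr mulr1; lra.
Qed.

Lemma sum_powRN_bound K e n : 1 <= K -> 0 < e -> e <= 1 ->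
  \sum_(i < n) (i%:R + K) `^ (- (1 + e)) <= 4 / e * K `^ (- e).
Proof.
move=> K1 e0 e1.
apply: (@le_trans _ _ (4 / e * (K `^ (- e) - (n%:R + K) `^ (- e)))); last first.
  by rewrite ler_pM2l ?divr_gt0 // gerBl powR_ge0.
elim: n => [|n IH]; first by rewrite big_ord0 add0r subrr mulr0.
rewrite big_ord_recr /=.
have := @powRN_telescope (n%:R + K) e _ e0 e1.
rewrite -addrA (addrC K) addrA -(natrD _ n 1) addn1.
have : 1 <= n%:R + K by rewrite (le_trans K1) // lerDr.
move=> h /(_ h); lra.
Qed.

(** The quantity 1 + L k grows at most by the factor 1 + C s k <= exp (C s k), and the exponents
    have bounded sums. *)
Lemma discrete_gronwall (L s : nat -> R) C S : 0 <= C ->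
  (forall k, 0 <= s k) -> (forall n, \sum_(i < n) s i <= S) ->
  (forall k, 0 <= L k) ->
  (forall k, L k.+1 <= L k + C * s k * (1 + L k)) ->
  exists B, forall k, L k <= B.
Proof.
move=> C0 s0 sS L0 hL; exists ((1 + L 0%N) * expR (C * S)) => k.
have L10 : 0 <= 1 + L 0%N by rewrite addr_ge0.
apply: (@le_trans _ _ ((1 + L 0%N) * expR (C * \sum_(i < k) s i))); last first.
  by rewrite ler_wpM2l // ler_expR ler_wpM2l.
suff : 1 + L k <= (1 + L 0%N) * expR (C * \sum_(i < k) s i) by lra.
elim: k => [|k IH]; first by rewrite big_ord0 mulr0 expR0 mulr1.
rewrite big_ord_recr /= mulrDr expRD mulrA.
apply: (@le_trans _ _ ((1 + L k) * (1 + C * s k))).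
  by have := hL k; lra.
apply: ler_pM => //; rewrite ?addr_ge0 ?mulr_ge0 //.
exact: expR_ge1Dx.
Qed.

(** If the target t decays by at most the factor 1 - a / 2, half of the contraction is free to
    absorb the forcing: (1 - a) D t + C a t <= (1 - a / 2) D t as soon as D >= 2 C. *)
Lemma contraction_rate (e t a : nat -> R) C k0 : 0 <= C ->
  (forall k, 0 < t k) ->
  (forall k, (k0 <= k)%N -> 0 <= a k <= 1) ->
  (forall k, (k0 <= k)%N -> (1 - a k / 2) * t k <= t k.+1) ->
  (forall k, e k.+1 <= (1 - a k) * e k + C * a k * t k) ->
  exists D, forall k, e k <= D * t k.
Proof.
move=> C0 t0 a01 ht he.
(* The sum stands in for a maximum over the indices up to [k0], where the hypotheses on a and t may
   fail. *)
pose D := 2 * C + \sum_(i < k0.+1) `|e i| / t i.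
have D0 : 2 * C <= D by rewrite lerDl sumr_ge0 // => i _; rewrite divr_ge0 // ltW.
exists D => k; have [kk0|] := leqP k k0.
  rewrite -ler_pdivrMr //.
  apply: (@le_trans _ _ (`|e k| / t k)).
    by rewrite ler_pM2r ?invr_gt0 // ler_norm.
  rewrite /D (bigD1 (inord k)) //= inordK // addrCA lerDl addr_ge0 ?mulr_ge0 //.
  by rewrite sumr_ge0 // => i _; rewrite divr_ge0 // ltW.
move=> /ltnW; elim: k => [|k IH].
  rewrite leqn0 => /eqP k00; rewrite -ler_pdivrMr //.
  rewrite /D k00 big_ord_recl big_ord0 /= addr0.
  apply: ler_wpDl; first by rewrite mulr_ge0.
  by rewrite ler_pM2r ?invr_gt0 // ler_norm.
rewrite leq_eqVlt => /predU1P[k0k|k0k].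
  rewrite -ler_pdivrMr //.
  apply: (@le_trans _ _ (`|e k.+1| / t k.+1)).
    by rewrite ler_pM2r ?invr_gt0 // ler_norm.
  rewrite /D k0k (bigD1 ord_max) //= addrCA lerDl addr_ge0 ?mulr_ge0 //.
  by rewrite sumr_ge0 // => i _; rewrite divr_ge0 // ltW.
have {}IH := IH k0k; have /andP[a0 a1] := a01 k k0k.
apply: (le_trans (he k)).
apply: (@le_trans _ _ (D * ((1 - a k / 2) * t k))); last first.
  by rewrite ler_wpM2l ?ht //; lra.
have h1 : (1 - a k) * e k <= (1 - a k) * (D * t k) by rewrite ler_wpM2l //; lra.
have h2 : a k * (C * t k) <= a k * (D / 2 * t k).
  by rewrite ler_wpM2l // ler_pM2r //; lra.
lra.
Qed.

Lemma powRN_eventually_le K p d : 0 <= K -> 0 < p -> 0 < d ->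
  exists k0, forall k, (k0 <= k)%N -> (k%:R + K) `^ (- p) <= d.
Proof.
move=> K0 p0 d0; pose y := (d^-1) `^ (p^-1).
have y0 : 0 < y by rewrite powR_gt0 // invr_gt0.
exists (Num.truncn y).+1 => k hk.
have yk : y <= k%:R + K.
  apply: (@le_trans _ _ k%:R); last by rewrite lerDl.
  by rewrite ltW // (lt_le_trans (Num.Theory.truncnS_gt y)) // ler_nat.
rewrite powRN -(invrK d) lef_pV2 ?posrE ?invr_gt0 ?powR_gt0 //; last first.
  by rewrite (lt_le_trans y0).
have -> : d^-1 = y `^ p.
  by rewrite /y -powRrM mulVf ?gt_eqF // powRr1 // invr_ge0 ltW.
by apply: ge0_ler_powR => //; rewrite ?nnegrE ltW // (lt_le_trans y0).
Qed.

(** The relative decrease of n^(-1/2) in one step is of order 1 / n, which a contraction of order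
    n^(-p) with p < 1 eventually beats. *)
Lemma sqrt_rate (e : nat -> R) K c C p : 1 <= K -> 0 < c -> 0 <= C ->
  0 < p -> p < 1 ->
  (forall k, e k.+1 <= (1 - c * (k%:R + K) `^ (- p)) * e k
     + C * (k%:R + K) `^ (- p) * (k%:R + K) `^ (- (1 / 2))) ->
  exists D, forall k, e k <= D * (k%:R + K) `^ (- (1 / 2)).
Proof.
move=> K1 c0 C0 p0 p1 he.
have K0 : 0 <= K by lra.
have q0 : 0 < 1 - p by lra.
have c2 : 0 < c / 2 by rewrite divr_gt0.
(* From [k1] on the contraction c x^(-p) is at most 1; from [k2] on 1 / x is at most half of it. *)
have [k1 hk1] := @powRN_eventually_le K p c^-1 K0 p0 (etrans (invr_gt0 c) c0).
have [k2 hk2] := @powRN_eventually_le K (1 - p) (c / 2) K0 q0 c2.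
have n1 k : 1 <= k%:R + K by rewrite (le_trans K1) // lerDr.
apply: (@contraction_rate e (fun k => (k%:R + K) `^ (- (1 / 2)))
  (fun k => c * (k%:R + K) `^ (- p)) (C / c) (maxn k1 k2)).
- by rewrite divr_ge0 // ltW.
- by move=> k; rewrite powR_gt0 // (lt_le_trans ltr01).
- move=> k; rewrite geq_max => /andP[k1k _]; apply/andP; split.
    by rewrite mulr_ge0 ?powR_ge0 ?(ltW c0).
  by rewrite mulrC -ler_pdivlMr // div1r hk1.
- move=> k; rewrite geq_max => /andP[_ k2k].
  have := hk2 k k2k; have := n1 k.
  rewrite -(addn1 k) natrD -addrA (addrC 1%:R K) addrA.
  move: (k%:R + K) => x x1; have x0 : 0 < x by lra.
  have x0' : x != 0 by rewrite gt_eqF.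
  rewrite opprB powRB ?x0' ?implybT // powRr1 ?(ltW x0) // => hx.
  have h1 : 1 - c * x `^ (- p) / 2 <= x / (x + 1).
    have -> : x / (x + 1) = 1 - (x + 1)^-1 by field; lra.
    have : x^-1 <= c / 2 * x `^ (- p).
      by rewrite mulrC powRN ler_pdivlMl ?x0' // ?powR_gt0 //.
    have : (x + 1)^-1 <= x^-1 by rewrite lef_pV2 ?posrE; lra.
    lra.
  apply: (@le_trans _ _ (x / (x + 1) * x `^ (- (1 / 2)))).
    by rewrite ler_pM2r ?powR_gt0.
  have : (x / (x + 1)) `^ 1 <= (x / (x + 1)) `^ (1 / 2).
    rewrite ger_powR //; last by lra.
    by rewrite divr_gt0 ?ler_pdivrMr; lra.
  rewrite powRr1 ?divr_ge0 ?(ltW x0) //; last by lra.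
  rewrite -(ler_pM2r (powR_gt0 (- (1 / 2)) x0)) => h; apply: (le_trans h).
  rewrite powRM ?invr_ge0 ?(ltW x0) //; last by lra.
  rewrite -(powR_inv1 (a := x + 1)); last by lra.
  rewrite -powRrM mulN1r mulrAC powRN mulfV ?mul1r //.
  by rewrite gt_eqF ?powR_gt0.
- move=> k; apply: (le_trans (he k)); rewrite lerD2l.
  by rewrite le_eqVlt; apply/orP; left; apply/eqP; field; rewrite gt_eqF.
Qed.

Lemma stepsizeE c K p k : stepsize c K p k = c * (k%:R + K) `^ (- p).
Proof. by rewrite /stepsize powRN. Qed.

(** * Step sizes and the resulting rates *)

Section step_sizes.
Variables (K eps a0 b0 : R).
Hypotheses (K1 : 1 <= K) (eps0 : 0 < eps) (eps4 : eps < 1 / 4).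
Hypotheses (a0_gt0 : 0 < a0) (b0_gt0 : 0 < b0).

Let al := stepsize a0 K (1 / 2 + 66 / 100 * eps).
Let be := stepsize b0 K (3 / 4 + eps).

Lemma stepsize_gt0 c p k : 0 < c -> 0 < stepsize c K p k.
Proof.
by move=> c0; rewrite divr_gt0 // powR_gt0 // ltr_wpDl // (lt_le_trans ltr01).
Qed.

(** The three bounds serve, in this order, the summability of the errors, the rate of the form Q,
    and the coupling term beta E[Z] in the supermartingale once E[Z] = O(n^(-1/2)) is known. *)
Lemma step_errors : exists2 M, 0 < M & forall k,
  [/\ al k ^+ 2 + be k ^+ 2 / al k + be k ^+ 2 <= M * (k%:R + K) `^ (- (1 + eps)),
      be k ^+ 2 <= M * (k%:R + K) `^ (- (3 / 4 + eps)) * (k%:R + K) `^ (- (1 / 2)) &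
      be k * (k%:R + K) `^ (- (1 / 2)) <= M * (k%:R + K) `^ (- (1 + eps))].
Proof.
exists (a0 ^+ 2 + b0 ^+ 2 / a0 + b0 ^+ 2 + b0).
  by rewrite !addr_gt0 ?divr_gt0 ?exprn_gt0.
have [e0 e4] := (eps0, eps4); move=> k; rewrite /al /be !stepsizeE.
have : 1 <= k%:R + K by rewrite (le_trans K1) // lerDr.
move: (k%:R + K) => x x1; have x0 : 0 < x by lra.
set a := 1 / 2 + _; set b := 3 / 4 + eps.
have q0 := powR_ge0 x (- (1 + eps)).
have sqE c p : (c * x `^ (- p)) ^+ 2 = c ^+ 2 * x `^ (- (p + p)).
  by rewrite powRN_addE // exprMn (expr2 (_ `^ _)).
have a1 : x `^ (- (a + a)) <= x `^ (- (1 + eps)) by rewrite powRN_le // /a; lra.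
have b1 : x `^ (- (b + b)) <= x `^ (- (1 + eps)) by rewrite powRN_le // /b; lra.
have b2 : x `^ (- (b + 1 / 2)) <= x `^ (- (1 + eps)) by rewrite powRN_le // /b; lra.
have b3 : x `^ (- (b + b)) <= x `^ (- (b + 1 / 2)) by rewrite powRN_le // /b; lra.
have ba : x `^ (- (b + b - a)) <= x `^ (- (1 + eps)) by rewrite powRN_le // /b /a; lra.
have baE : b0 ^+ 2 * x `^ (- (b + b)) / (a0 * x `^ (- a))
         = b0 ^+ 2 / a0 * x `^ (- (b + b - a)).
  have -> : b + b = (b + b - a) + a by lra.
  rewrite powRN_addE // addrK; field.
  by rewrite !gt_eqF ?powR_gt0.
have [a2 [b02 [ab b0']]] : 0 <= a0 ^+ 2 /\ 0 <= b0 ^+ 2 /\ 0 <= b0 ^+ 2 / a0 /\ 0 <= b0.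
  by rewrite divr_ge0 ?sqr_ge0 ?(ltW a0_gt0) ?(ltW b0_gt0).
rewrite !sqE baE; split.
- have := ler_wpM2l a2 a1; have := ler_wpM2l b02 b1; have := ler_wpM2l ab ba.
  have := mulr_ge0 b0' q0; lra.
- rewrite -(mulrA (a0 ^+ 2 + _ + _ + _)) -powRN_addE //.
  by apply: ler_pM => //; rewrite ?powR_ge0 //; lra.
- rewrite -(mulrA b0) -powRN_addE //.
  by apply: ler_pM => //; rewrite ?powR_ge0 //; lra.
Qed.

(* The terms [c * al * e] cancel in the sum of the first two recursions, which
   bounds [e + v]. *)
Lemma two_timescale_rates (e v q : nat -> R) c c' C : 0 < c -> 0 < c' -> 0 <= C ->
  (forall k, 0 <= e k) -> (forall k, 0 <= v k) ->
  (forall k, e k.+1 <= (1 - c * al k) * e k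
     + C * (al k ^+ 2 + be k ^+ 2 / al k + be k ^+ 2) * (1 + (e k + v k))) ->
  (forall k, v k.+1 <= v k + c * al k * e k
     + C * (al k ^+ 2 + be k ^+ 2 / al k + be k ^+ 2) * (1 + (e k + v k))) ->
  (forall k, q k.+1 <= (1 - c' * be k) * q k + C * be k * e k
     + C * be k ^+ 2 * (1 + (e k + v k))) ->
  exists D, forall k, [/\ e k + v k <= D, e k <= D * (k%:R + K) `^ (- (1 / 2)) &
    q k <= D * (k%:R + K) `^ (- (1 / 2))].
Proof.
move=> c0 c'0 C0 e0 v0 he hv hq; have [eps_gt0 eps_lt4] := (eps0, eps4).
have [M M0 hM] := step_errors.
have n1 k : 1 <= k%:R + K by rewrite (le_trans K1) // lerDr.
have [B hB] : exists B, forall k, e k + v k <= B.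
  apply: (@discrete_gronwall _ (fun k => (k%:R + K) `^ (- (1 + eps))) (2 * C * M)
    (4 / eps * K `^ (- eps))).
  - by rewrite !mulr_ge0 // ltW.
  - by move=> k; rewrite powR_ge0.
  - by move=> n; apply: sum_powRN_bound => //; lra.
  - by move=> k; rewrite addr_ge0.
  - move=> k; have [h _ _] := hM k; have := he k; have := hv k.
    have s0 : 0 <= 1 + (e k + v k) by rewrite !addr_ge0.
    have := ler_wpM2r s0 (ler_wpM2l C0 h); lra.
have B0 : 0 <= B by apply: le_trans (hB 0%N); rewrite addr_ge0.
have h1B k : 1 + (e k + v k) <= 1 + B by rewrite lerD2l.
have h1B0 : 0 <= 1 + B by lra.
have E0 k : 0 <= al k ^+ 2 + be k ^+ 2 / al k + be k ^+ 2.
  have al0 : 0 < al k by rewrite stepsize_gt0.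
  by rewrite addr_ge0 ?sqr_ge0 // addr_ge0 ?sqr_ge0 // divr_ge0 ?sqr_ge0 // ltW.
(* The errors n^-(1 + eps) are below alpha n^(-1/2), of order n^-(1 + 0.66 eps), which is the
   forcing that [sqrt_rate] allows. *)
have [D1 hD1] : exists D, forall k, e k <= D * (k%:R + K) `^ (- (1 / 2)).
  apply: (@sqrt_rate e K (c * a0) (C * M * (1 + B)) (1 / 2 + 66 / 100 * eps)) => //.
  - by rewrite mulr_gt0.
  - by rewrite !mulr_ge0 // ltW.
  - lra.
  - lra.
  move=> k; apply: (le_trans (he k)); rewrite {1}/al stepsizeE mulrA lerD2l.
  have [h _ _] := hM k; rewrite -[leRHS]mulrA -powRN_addE //.
  apply: (@le_trans _ _ (C * (M * (k%:R + K) `^ (- (1 + eps))) * (1 + B))).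
    apply: ler_pM => //; last by rewrite ler_wpM2l.
      by rewrite mulr_ge0.
    by rewrite !addr_ge0.
  rewrite mulrA [leLHS]mulrAC ler_wpM2l ?mulr_ge0 ?(ltW M0) //.
  by rewrite powRN_le //; lra.
have D10 : 0 <= D1.
  have := le_trans (e0 0%N) (hD1 0%N).
  by rewrite pmulr_lge0 // powR_gt0 // (lt_le_trans ltr01).
(* The forcing beta e has the form beta n^(-1/2) by the rate just found, so q inherits that rate.
   Here eps < 1/4 makes the exponent of beta less than 1. *)
have [D2 hD2] : exists D, forall k, q k <= D * (k%:R + K) `^ (- (1 / 2)).
  apply: (@sqrt_rate q K (c' * b0) (C * b0 * D1 + C * M * (1 + B)) (3 / 4 + eps)) => //.
  - by rewrite mulr_gt0.
  - by rewrite !addr_ge0 // !mulr_ge0 // ltW.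
  - lra.
  - lra.
  move=> k; apply: (le_trans (hq k)).
  rewrite {1}/be stepsizeE mulrA -addrA lerD2l.
  have [_ h _] := hM k; rewrite 2!mulrDl lerD //.
    rewrite /be stepsizeE; have := hD1 k.
    have : 0 <= C * b0 * (k%:R + K) `^ (- (3 / 4 + eps)).
      by rewrite !mulr_ge0 ?powR_ge0 // ltW.
    move=> p0 /(ler_wpM2l p0); lra.
  apply: (@le_trans _ _ (C * (M * (k%:R + K) `^ (- (3 / 4 + eps))
     * (k%:R + K) `^ (- (1 / 2))) * (1 + B))); last by rewrite le_eqVlt; apply/orP; left; apply/eqP; ring.
  apply: ler_pM => //; last by rewrite ler_wpM2l.
    by rewrite mulr_ge0 // sqr_ge0.
  by rewrite !addr_ge0.
have t0 k : 0 <= (k%:R + K) `^ (- (1 / 2)) by rewrite powR_ge0.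
exists (Num.max B (Num.max D1 D2)) => k; split.
- by rewrite (le_trans (hB k)) // le_max lexx.
- by rewrite (le_trans (hD1 k)) // ler_wpM2r // !le_max lexx !orbT.
- by rewrite (le_trans (hD2 k)) // ler_wpM2r // !le_max lexx !orbT.
Qed.

End step_sizes.

End real_sequences.

(** * Conditioning on a sub-sigma-algebra *)

Section sub_sigma_algebra.
Context (R : realType) (d : measure_display) (T : measurableType d).
Variables (P : probability T R) (G : set (set T)).
Hypothesis GT : <<s G >> `<=` measurable.

Definition submeas (h : T -> R) : Prop :=
  measurable_fun (setT : set (g_sigma_algebraType G)) h.

Lemma submeas_measurable h : submeas h -> measurable_fun setT h.
Proof. by move=> mh _ B mB; apply: GT; exact: (mh measurableT B mB). Qed.

Import HBNNSimple.
Local Open Scope ereal_scope.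

(** Substitute for pulling a known factor h out of a conditional expectation: the comparison on sets
    passes to simple functions by finite sums, then to h by monotone convergence. *)
Lemma le_integral_submeas (f g h : T -> R) :
  measurable_fun setT f -> measurable_fun setT g -> submeas h ->
  (forall w, 0 <= f w)%R -> (forall w, 0 <= g w)%R -> (forall w, 0 <= h w)%R ->
  (forall A, <<s G >> A -> \int[P]_(w in A) (f w)%:E <= \int[P]_(w in A) (g w)%:E) ->
  \int[P]_w (f w * h w)%:E <= \int[P]_w (g w * h w)%:E.
Proof.
move=> mf mg mh f0 g0 h0 fg.
have mEh := (@measurable_EFinP _ (g_sigma_algebraType G) R setT h).2 mh.
(* The approximants are taken for the small sigma-algebra, so that their level sets belong to
   [<<s G >>], where f and g are compared. *)
pose a := @nnsfun_approx _ (g_sigma_algebraType G) R setT measurableT _ mEh.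
have ma n : submeas (a n) by exact: measurable_funP.
have a0 n w : (0 <= a n w)%R by exact: fun_ge0.
have aE n (k : T -> R) : measurable_fun setT k -> (forall w, 0 <= k w)%R ->
    \int[P]_w (k w * a n w)%:E =
    \sum_(y \in range (a n)) y%:E * \int[P]_(w in a n @^-1` [set y]) (k w)%:E.
  move=> mk k0.
  have mI y : measurable (a n @^-1` [set y] : set T).
    by apply: GT; rewrite -[X in <<s _ >> X]setTI; exact: (ma n measurableT).
  transitivity (\int[P]_w \sum_(y \in range (a n))
      (y * (k w * \1_(a n @^-1` [set y]) w))%:E).
    apply: eq_integral => w _.
    rewrite fsumEFin //; congr (_%:E).
    rewrite {1}(fimfunE (a n) w) mulrC mulr_fsuml; apply: eq_fsbigr => y _.
    by rewrite -mulrA (mulrC (\1__ _)).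
  rewrite ge0_integral_fsum //.
  - apply: eq_fsbigr => y /set_mem [w _ <-].
    under eq_integral do rewrite EFinM.
    rewrite ge0_integralZl //.
    + congr (_ * _); rewrite [RHS]integral_mkcond; apply: eq_integral => t _.
      by rewrite epatch_indic /= -EFinM.
    + by apply/measurable_EFinP; apply: measurable_funM.
    + by move=> t _; rewrite lee_fin mulr_ge0.
    + by rewrite lee_fin.
  - move=> y; apply/measurable_EFinP; apply: measurable_funM => //.
    by apply: measurable_funM.
  - move=> y w _; rewrite lee_fin mulrCA mulr_ge0 // -lee_fin.
    exact: nnfun_muleindic_ge0.
have cv (k : T -> R) : measurable_fun setT k -> (forall w, 0 <= k w)%R ->
    \int[P]_w (k w * a n w)%:E @[n --> \oo] --> \int[P]_w (k w * h w)%:E.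
  move=> mk k0.
  have kh w : (k w * h w)%:E = lim ((k w * a n w)%:E @[n --> \oo]).
    apply/esym/cvg_lim => //; under eq_fun do rewrite EFinM.
    rewrite EFinM; apply: cvgeZl => //.
    exact: (@cvg_nnsfun_approx _ _ _ _ measurableT _ mEh (fun w _ => h0 w) w).
  under [X in _ --> X]eq_integral do rewrite kh.
  apply: cvg_monotone_convergence => //.
  - move=> n; apply/measurable_EFinP; apply: measurable_funM => //.
    exact: submeas_measurable.
  - by move=> n w _; rewrite lee_fin mulr_ge0.
  - move=> w _ m n mn; rewrite lee_fin ler_wpM2l //.
    by have /lefP := @nd_nnsfun_approx _ _ _ _ measurableT _ mEh m n mn; apply.
rewrite -(cvg_lim _ (cv f mf f0)) // -(cvg_lim _ (cv g mg g0)) //.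
apply: lee_lim; do ?[by apply/cvg_ex; eexists; exact: cv].
apply: nearW => n; rewrite !aE //.
apply: lee_fsum => // y [w _ <-]; rewrite lee_wpmul2l ?lee_fin //.
apply: fg; rewrite -[X in <<s _ >> X]setTI; exact: (ma n measurableT).
Qed.

End sub_sigma_algebra.

(** * Real-valued integrals over sets, and square integrability *)

Section integrals.
Context (R : realType) (d : measure_display) (T : measurableType d).
Variable P : probability T R.
Implicit Types (f g : T -> R) (A : set T) (c : R).

Definition integ (f : T -> R) : Prop := P.-integrable setT (EFin \o f).

(** With A ranging over a sub-sigma-algebra, inequalities between these integrals express
    inequalities between conditional expectations. *)
Definition Eon (A : set T) (f : T -> R) : R := \int[P]_(w in A) f w.

Lemma integ_measurable f : integ f -> measurable_fun setT f.
Proof. by move=> /measurable_int /measurable_EFinP. Qed.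

Lemma integS A f : measurable A -> integ f -> P.-integrable A (EFin \o f).
Proof. by move=> mA; apply: integrableS. Qed.

Lemma integ_le (f g : T -> R) : measurable_fun setT f -> integ g ->
  (forall w, `|f w| <= g w) -> integ f.
Proof.
move=> mf ig fg; apply: le_integrable ig => //; first exact/measurable_EFinP.
by move=> w _ /=; rewrite lee_fin (le_trans (fg w)) // ler_norm.
Qed.

Lemma integD f g : integ f -> integ g -> integ (fun w => f w + g w).
Proof. by move=> hf hg; exact: (integrableD measurableT hf hg). Qed.

Lemma integZ c f : integ f -> integ (fun w => c * f w).
Proof. by move=> hf; exact: (integrableZl measurableT c hf). Qed.

Lemma integ_cst c : integ (cst c).
Proof. exact: finite_measure_integrable_cst. Qed.

Lemma integ_abs f : integ f -> integ (fun w => `|f w|).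
Proof.
move=> hf; have := integrable_norm hf.
by apply: eq_integrable.
Qed.

Lemma integ_sum (I : Type) (s : seq I) (f : I -> T -> R) :
  (forall i, integ (f i)) -> integ (fun w => \sum_(i <- s) f i w).
Proof.
move=> hf; elim: s => [|i s IH].
  by under eq_fun do rewrite big_nil; exact: integ_cst.
by under eq_fun do rewrite big_cons; exact: integD.
Qed.

Lemma EonE A f : measurable A -> integ f ->
  (\int[P]_(w in A) (f w)%:E = (Eon A f)%:E)%E.
Proof.
move=> mA hf; rewrite /Eon /Rintegral fineK //.
by apply: integrable_fin_num => //; exact: integS.
Qed.

Lemma EonD A f g : measurable A -> integ f -> integ g ->
  Eon A (fun w => f w + g w) = Eon A f + Eon A g.
Proof. by move=> mA hf hg; apply: RintegralD => //; exact: integS. Qed.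

Lemma EonZ A c f : measurable A -> integ f ->
  Eon A (fun w => c * f w) = c * Eon A f.
Proof. by move=> mA hf; apply: RintegralZl => //; exact: integS. Qed.

Lemma Eon_le A f g : measurable A -> integ f -> integ g ->
  (forall w, f w <= g w) -> Eon A f <= Eon A g.
Proof. by move=> mA hf hg fg; apply: le_Rintegral => //; exact: integS. Qed.

Lemma Eon_ge0 A f : (forall w, 0 <= f w) -> 0 <= Eon A f.
Proof. by move=> f0; exact: Rintegral_ge0. Qed.

Lemma Eon_cst A c : measurable A -> Eon A (cst c) = c * fine (P A).
Proof. by move=> mA; exact: Rintegral_cst. Qed.

Lemma Eon_sum A (I : Type) (s : seq I) (f : I -> T -> R) : measurable A ->
  (forall i, integ (f i)) ->
  Eon A (fun w => \sum_(i <- s) f i w) = \sum_(i <- s) Eon A (f i).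
Proof.
move=> mA hf; elim: s => [|i s IH].
  rewrite big_nil /Eon; under eq_Rintegral do rewrite big_nil.
  by rewrite -/(Eon A (cst 0)) Eon_cst // mul0r.
rewrite big_cons -IH -EonD //; last exact: integ_sum.
by congr Eon; apply/funext => w; rewrite big_cons.
Qed.

Lemma Eon_indic A f : measurable A ->
  Eon A f = Eon setT (fun w => f w * \1_A w).
Proof.
move=> mA; rewrite /Eon Rintegral_mkcond; congr Rintegral; apply/funext => w.
by rewrite patchE indicE; case: ifPn; rewrite ?mulr1 ?mulr0.
Qed.

Definition L2 (f : T -> R) : Prop :=
  measurable_fun setT f /\ integ (fun w => f w ^+ 2).

Lemma L2_measurable f : L2 f -> measurable_fun setT f.
Proof. by case. Qed.

Lemma L2_mul f g : L2 f -> L2 g -> integ (fun w => f w * g w).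
Proof.
move=> [mf f2] [mg g2]; apply: (integ_le _ (integD f2 g2)).
  exact: measurable_funM.
move=> w; rewrite ler_norml.
have := sqr_ge0 (f w + g w); have := sqr_ge0 (f w - g w).
by have := sqr_ge0 (f w); have := sqr_ge0 (g w); rewrite sqrrB sqrrD; lra.
Qed.

Lemma L2D f g : L2 f -> L2 g -> L2 (fun w => f w + g w).
Proof.
move=> hf hg; split; first by apply: measurable_funD; exact: L2_measurable.
have h := integD (integD hf.2 hg.2) (integZ 2 (L2_mul hf hg)).
rewrite (_ : (fun w => _) = fun w => (f w ^+ 2 + g w ^+ 2) + 2 * (f w * g w)) //.
by apply/funext => w; ring.
Qed.

Lemma L2Z c f : L2 f -> L2 (fun w => c * f w).
Proof.
move=> [mf hf]; split; first exact: measurable_funM.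
rewrite (_ : (fun w => _) = fun w => c ^+ 2 * f w ^+ 2); first exact: integZ.
by apply/funext => w; rewrite exprMn.
Qed.

Lemma L2_cst c : L2 (cst c).
Proof. by split => //; exact: (integ_cst (c ^+ 2)). Qed.

Lemma L2_integ f : L2 f -> integ f.
Proof.
move=> hf; rewrite (_ : f = fun w => f w * cst 1 w).
  exact: L2_mul (L2_cst 1).
by apply/funext => w; rewrite mulr1.
Qed.

Lemma L2_sum (I : Type) (s : seq I) (f : I -> T -> R) :
  (forall i, L2 (f i)) -> L2 (fun w => \sum_(i <- s) f i w).
Proof.
move=> hf; elim: s => [|i s IH].
  by under eq_fun do rewrite big_nil; exact: L2_cst.
by under eq_fun do rewrite big_cons; exact: L2D.
Qed.

End integrals.

(** * Noise that is centered given a sub-sigma-algebra *)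

Section noise.
Context (R : realType) (d : measure_display) (T : measurableType d).
Variables (P : probability T R) (G : set (set T)).
Hypothesis GT : <<s G >> `<=` measurable.
Implicit Types (f g h m a H : T -> R) (A : set T) (c C : R).

Lemma submeasD f g : submeas G f -> submeas G g -> submeas G (fun w => f w + g w).
Proof. exact: measurable_funD. Qed.

Lemma submeasM f g : submeas G f -> submeas G g -> submeas G (fun w => f w * g w).
Proof. exact: measurable_funM. Qed.

Lemma submeas_cst c : submeas G (cst c : T -> R).
Proof. exact: measurable_cst. Qed.

Lemma submeas_abs f : submeas G f -> submeas G (fun w => `|f w|).
Proof. by move=> mf; apply: measurableT_comp. Qed.

Lemma submeas_indic (A : set T) : <<s G >> A -> submeas G (\1_A : T -> R).
Proof. by move=> sA; exact: measurable_indic. Qed.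

Lemma submeas_sum (I : Type) (s : seq I) (f : I -> T -> R) :
  (forall i, submeas G (f i)) -> submeas G (fun w => \sum_(i <- s) f i w).
Proof.
move=> hf; elim: s => [|i s IH].
  by under eq_fun do rewrite big_nil; exact: submeas_cst.
by under eq_fun do rewrite big_cons; exact: submeasD.
Qed.

(** Comparison over the whole space first yields a finite integral for f h; using h times the
    indicator of A as the factor then localizes the inequality to A. *)
Lemma Eon_le_submeas f g h : integ P f -> integ P g ->
  integ P (fun w => g w * h w) -> submeas G h ->
  (forall w, 0 <= f w) -> (forall w, 0 <= g w) -> (forall w, 0 <= h w) ->
  (forall A, <<s G >> A -> Eon P A f <= Eon P A g) ->
  integ P (fun w => f w * h w) /\
  (forall A, <<s G >> A ->
    Eon P A (fun w => f w * h w) <= Eon P A (fun w => g w * h w)).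
Proof.
move=> hf hg hgh mh f0 g0 h0 fg.
have mf := integ_measurable hf; have mg := integ_measurable hg.
have key k : submeas G k -> (forall w, 0 <= k w) ->
    (\int[P]_w (f w * k w)%:E <= \int[P]_w (g w * k w)%:E)%E.
  move=> mk k0; apply: (le_integral_submeas GT) => // A sA.
  by rewrite !EonE ?lee_fin //; [exact: fg| exact: GT| exact: GT].
have fh0 w : 0 <= f w * h w by rewrite mulr_ge0.
have mfh : measurable_fun setT (fun w => f w * h w).
  by apply: measurable_funM => //; exact: submeas_measurable mh.
have ifh : integ P (fun w => f w * h w).
  apply/integrableP; split; first exact/measurable_EFinP.
  apply: (@le_lt_trans _ _ (\int[P]_w (f w * h w)%:E)%E).
    apply: ge0_le_integral => //=.
    - by apply/measurable_EFinP; exact: measurableT_comp.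
    - exact/measurable_EFinP.
    - by move=> w _; rewrite lee_fin ger0_norm.
  by apply: (le_lt_trans (key h mh h0)); rewrite EonE // ltry.
split => // A sA; have mA := GT sA.
rewrite [leLHS]Eon_indic // [leRHS]Eon_indic // -lee_fin.
have iI (k : T -> R) : integ P k -> integ P (fun w => k w * \1_A w).
  move=> ik; apply: (integ_le _ (integ_abs ik)).
    by apply: measurable_funM; [exact: integ_measurable ik|exact: measurable_indic].
  move=> w; rewrite normrM indicE; case: (w \in A); rewrite ?normr1 ?mulr1 //.
  by rewrite normr0 mulr0.
rewrite -!EonE //; [|exact: iI|exact: iI].
have := key (fun w => h w * \1_A w) (submeasM mh (submeas_indic sA)).
under eq_integral do rewrite mulrA; under [leRHS]eq_integral do rewrite mulrA.
by apply => w; rewrite mulr_ge0.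
Qed.

(* [E[X | G] = 0] and [E[X ^ 2 | G] <= c], tested on the sets of [<<s G >>]. *)
Definition centered (c : R) (X : T -> R) : Prop :=
  [/\ L2 P X, forall A, <<s G >> A -> Eon P A X = 0 &
      forall A, <<s G >> A -> Eon P A (fun w => X w ^+ 2) <= c * Eon P A (cst 1)].

(* Orthogonality to a nonnegative [h] follows by comparing [|X| + X] with
   [|X|]; a general [Y] is [(|Y| + Y) - |Y|]. *)
Lemma centered_orthogonal c X Y A : centered c X -> submeas G Y ->
  integ P (fun w => X w * Y w) -> <<s G >> A ->
  Eon P A (fun w => X w * Y w) = 0.
Proof.
move=> [LX X0 _] mY iXY sA; have mA := GT sA.
have iX := L2_integ LX; have iaX := integ_abs iX.
have nonneg h : submeas G h -> (forall w, 0 <= h w) ->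
    integ P (fun w => X w * h w) -> Eon P A (fun w => X w * h w) = 0.
  move=> mh h0 ih.
  have iah : integ P (fun w => `|X w| * h w).
    have := integ_abs ih; congr integ; apply/funext => w.
    by rewrite normrM (ger0_norm (h0 w)).
  have iXX : integ P (fun w => `|X w| + X w) by exact: integD.
  have iXXh : integ P (fun w => (`|X w| + X w) * h w).
    have := integD iah ih; congr integ; apply/funext => w; ring.
  have XX0 w : 0 <= `|X w| + X w by have := ler_norm (- X w); rewrite normrN; lra.
  have XXE B : <<s G >> B ->
      Eon P B (fun w => `|X w| + X w) = Eon P B (fun w => `|X w|).
    by move=> sB; rewrite EonD ?X0 ?addr0 //; exact: GT.
  have XXl B : <<s G >> B ->
      Eon P B (fun w => `|X w| + X w) <= Eon P B (fun w => `|X w|).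
    by move=> sB; rewrite XXE.
  have XXr B : <<s G >> B ->
      Eon P B (fun w => `|X w|) <= Eon P B (fun w => `|X w| + X w).
    by move=> sB; rewrite XXE.
  have [_ h1] := @Eon_le_submeas (fun w => `|X w| + X w) (fun w => `|X w|) h
    iXX iaX iah mh XX0 (fun w => normr_ge0 _) h0 XXl.
  have [_ h2] := @Eon_le_submeas (fun w => `|X w|) (fun w => `|X w| + X w) h
    iaX iXX iXXh mh (fun w => normr_ge0 _) XX0 h0 XXr.
  have e : Eon P A (fun w => (`|X w| + X w) * h w) =
           Eon P A (fun w => `|X w| * h w) + Eon P A (fun w => X w * h w).
    by rewrite -EonD //; congr Eon; apply/funext => w; rewrite mulrDl.
  by have := h1 A sA; have := h2 A sA; rewrite e; lra.
have iXaY : integ P (fun w => X w * `|Y w|).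
  apply: (integ_le _ (integ_abs iXY)).
    apply: measurable_funM; first exact: LX.1.
    exact: (submeas_measurable GT (submeas_abs mY)).
  by move=> w; rewrite !normrM normr_id.
have iXaYY : integ P (fun w => X w * (`|Y w| + Y w)).
  have := integD iXaY iXY; congr integ; apply/funext => w; ring.
have e1 := nonneg _ (submeas_abs mY) (fun w => normr_ge0 _) iXaY.
have e2 := nonneg _ (submeasD (submeas_abs mY) mY) _ iXaYY.
have e3 : Eon P A (fun w => X w * (`|Y w| + Y w)) =
  Eon P A (fun w => X w * `|Y w|) + Eon P A (fun w => X w * Y w).
  by rewrite -EonD //; congr Eon; apply/funext => w; rewrite mulrDr.
rewrite e3 e1 add0r in e2; apply: e2 => w.
by have := ler_norm (- Y w); rewrite normrN; lra.
Qed.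

(** A product of two square-integrable functions need not be square integrable. Here it is, because
    the conditional second moment of X is at most c: compare X^2 with c under the weight Y^2. *)
Lemma centered_mul_bound c X Y : centered c X -> submeas G Y -> L2 P Y -> 0 <= c ->
  L2 P (fun w => X w * Y w) /\
  (forall A, <<s G >> A -> Eon P A (fun w => (X w * Y w) ^+ 2) <=
                           c * Eon P A (fun w => Y w ^+ 2)).
Proof.
move=> [LX X0 X2] mY LY c0.
have [] := @Eon_le_submeas (fun w => X w ^+ 2) (cst c) (fun w => Y w ^+ 2)
  LX.2 (integ_cst P c).
- exact: integZ LY.2.
- by have := submeasM mY mY; congr submeas; apply/funext => w; rewrite expr2.
- by move=> w; exact: sqr_ge0.
- by [].
- by move=> w; exact: sqr_ge0.
- move=> A sA; apply: (le_trans (X2 A sA)).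
  by rewrite !Eon_cst ?mul1r //; exact: GT.
move=> i h.
have e : (fun w => (X w * Y w) ^+ 2) = (fun w => X w ^+ 2 * Y w ^+ 2).
  by apply/funext => w; rewrite exprMn.
split; first split.
- by apply: measurable_funM; [exact: LX.1|exact: LY.1].
- by rewrite e.
move=> A sA; rewrite e (le_trans (h A sA)) // EonZ //; [exact: GT|exact: LY.2].
Qed.

(* [E[m | G] = 0] and [E[m ^ 2 | G] <= C E[H | G]], again without conditional
   expectations. *)
Definition noisy (H : T -> R) (C : R) (m : T -> R) : Prop :=
  [/\ L2 P m,
      forall a A, submeas G a -> L2 P a -> <<s G >> A -> Eon P A (fun w => a w * m w) = 0 &
      forall A, <<s G >> A -> Eon P A (fun w => m w ^+ 2) <= C * Eon P A H].

(** Meant for X an entry of an estimation error and Y the constant 1 or a coordinate of an iterate.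
    The common majorant H lets the resulting terms be added up. *)
Lemma centered_noisy H c C X Y : centered c X -> submeas G Y -> L2 P Y -> 0 <= c ->
  integ P H -> (forall w, Y w ^+ 2 <= C * H w) ->
  noisy H (c * C) (fun w => X w * Y w).
Proof.
move=> cX mY LY c0 iH YH; have [L h] := centered_mul_bound cX mY LY c0; split => //.
- move=> a A ma La sA.
  have e : (fun w => a w * (X w * Y w)) = (fun w => X w * (a w * Y w)).
    by apply/funext => w; rewrite mulrCA.
  rewrite e; apply: (centered_orthogonal cX) => //; first exact: submeasM.
  by rewrite -e; exact: L2_mul.
- move=> A sA; apply: (le_trans (h A sA)); rewrite -mulrA ler_wpM2l // -EonZ //.
    by apply: Eon_le => //; [exact: GT|exact: LY.2|exact: integZ].
  exact: GT.
Qed.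

(** The two terms may be correlated, hence (m + m')^2 <= 2 m^2 + 2 m'^2. *)
Lemma noisyD H C C' m m' : noisy H C m -> noisy H C' m' -> 
  noisy H (2 * C + 2 * C') (fun w => m w + m' w).
Proof.
move=> [L e h] [L' e' h']; split; first exact: L2D.
- move=> a A ma La sA; under [X in Eon P A X]eq_fun do rewrite mulrDr.
  by rewrite EonD ?e ?e' ?addr0 //; [exact: GT| exact: L2_mul|exact: L2_mul].
- move=> A sA; have mA := GT sA.
  apply: (@le_trans _ _ (Eon P A (fun w => 2 * m w ^+ 2 + 2 * m' w ^+ 2))).
    apply: Eon_le => //; first exact: (L2D L L').2.
      by apply: integD; apply: integZ; [exact: L.2|exact: L'.2].
    by move=> w; have := sqr_ge0 (m w - m' w); rewrite sqrrB sqrrD; lra.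
  have [[_ iL] [_ iL']] := (L, L').
  rewrite EonD //; [|exact: integZ|exact: integZ].
  by rewrite !EonZ //; have := h A sA; have := h' A sA; lra.
Qed.

Lemma noisyN H C m : noisy H C m -> noisy H C (fun w => - m w).
Proof.
move=> [L e h]; have eN : (fun w => - m w) = (fun w => -1 * m w).
  by apply/funext => w; rewrite mulN1r.
split; first by rewrite eN; exact: L2Z.
- move=> a A ma La sA; under [X in Eon P A X]eq_fun do rewrite mulrN -mulN1r.
  by rewrite EonZ ?e ?mulr0 //; [exact: GT|exact: L2_mul].
- by move=> A sA; under [X in Eon P A X]eq_fun do rewrite sqrrN; exact: h.
Qed.

Lemma noisy0 H : (forall w, 0 <= H w) -> noisy H 0 (cst 0).
Proof.
move=> H0; split; first exact: L2_cst.
- move=> a A ma La sA; under [X in Eon P A X]eq_fun do rewrite mulr0.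
  by rewrite Eon_cst ?mul0r //; exact: GT.
- move=> A sA; under [X in Eon P A X]eq_fun do rewrite expr0n.
  by rewrite Eon_cst ?mul0r //; exact: GT.
Qed.

End noise.

(** The constant is chosen before the probability space and the sigma-algebra, so that one constant
    serves all times. *)
Lemma noisy_sum (R : realType) (C : R) (n : nat) : exists C', forall
  (d : measure_display) (T : measurableType d) (P : probability T R)
  (G : set (set T)) (H : T -> R) (m : 'I_n -> T -> R),
  <<s G >> `<=` measurable -> (forall w, 0 <= H w) ->
  (forall i, noisy P G H C (m i)) -> noisy P G H C' (fun w => \sum_(i < n) m i w).
Proof.
elim: n => [|n [C' IH]].
  exists 0 => d T P G H m GT H0 _; under eq_fun do rewrite big_ord0.
  exact: noisy0.
exists (2 * C' + 2 * C) => d T P G H m GT H0 hm.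
under eq_fun do rewrite big_ord_recr /=.
apply: noisyD => //; exact: IH.
Qed.

(** * Maximal inequality *)

(* [tau k] bounds the sum of the errors made from time [k] on. *)
Section maximal_inequality.
Context (R : realType) (d : measure_display) (T : measurableType d).
Variables (P : probability T R) (G : nat -> set (set T)).
Variables (V : nat -> T -> R) (tau : nat -> R).
Hypothesis GT : forall k, <<s G k >> `<=` measurable.
Hypothesis GS : forall k, <<s G k >> `<=` <<s G k.+1 >>.
Hypothesis mV : forall k, submeas (G k) (V k).
Hypothesis iV : forall k, integ P (V k).
Hypothesis V0 : forall k w, 0 <= V k w.
Hypothesis tau0 : forall k, 0 <= tau k.
Hypothesis hV : forall k A, <<s G k >> A ->
  Eon P A (V k.+1) <= Eon P A (V k) + (tau k - tau k.+1).

Let E (a : R) k : set T := [set w | a <= V k w].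
Let U a k j : set T := \big[setU/set0]_(i < j) E a (k + i)%N.

Let sE a k : <<s G k >> (E a k).
Proof.
have -> : E a k = setT `&` V k @^-1` `[a, +oo[.
  by apply/seteqP; split => w /=; rewrite in_itv /= andbT // => -[].
exact: (@mV k measurableT [set` `[a, +oo[] (measurable_itv _)).
Qed.

Let sU a k j : <<s G (k + j)%N >> (U a k j).
Proof.
elim: j => [|j IH].
  by rewrite /U big_ord0; exact: (@measurable0 _ (g_sigma_algebraType (G (k + 0)%N))).
rewrite addnS; apply: GS; rewrite /U big_ord_recr /=.
exact: (@measurableU _ (g_sigma_algebraType (G (k + j)%N)) _ _ IH (@sE a (k + j)%N)).
Qed.

(** [U a k j.+1] involves only the times k, ..., k + j and is thus known at time k + j, at which
    [hV] will be applied to its complement. *)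
Let sUC a k j : <<s G (k + j)%N >> (~` U a k j.+1).
Proof.
apply: (@measurableC _ (g_sigma_algebraType (G (k + j)%N))).
rewrite /U big_ord_recr /=.
exact: (@measurableU _ (g_sigma_algebraType (G (k + j)%N)) _ _
  (@sU a k j) (@sE a (k + j)%N)).
Qed.

Let EonU A B f : measurable A -> measurable B -> integ P f -> A `&` B = set0 ->
  Eon P (A `|` B) f = Eon P A f + Eon P B f.
Proof.
move=> mA mB hf AB; apply: Rintegral_setU => //; last by apply/disj_setPS; rewrite AB.
by apply: integS => //; exact: measurableU.
Qed.

(** Doob's argument, stopping at the first passage above a: the part newly stopped at time k + j
    carries at least a times its probability, and [hV] is applied to the part still running. There
    is one application per time, so the errors telescope in tau even though they carry no factor P
    A. *)
Lemma supermartingale_maximal a k j : 0 <= a ->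
  a * Eon P (U a k j) (cst 1) + Eon P (~` U a k j) (V (k + j)%N) + tau (k + j)%N
    <= Eon P setT (V k) + tau k.
Proof.
move=> a0; elim: j => [|j IH].
  rewrite addn0 /U big_ord0 setC0 Eon_cst ?measure0 //= mul1r mulr0 add0r //.
apply: le_trans IH.
have mU := GT (@sU a k j); have mE := GT (@sE a (k + j)%N); have mUC := GT (@sUC a k j).
have UE : U a k j.+1 = U a k j `|` (E a (k + j)%N `\` U a k j).
  rewrite {1}/U big_ord_recr /= -/(U a k j).
  apply/seteqP; split => w [Uw|]; [by left| |by left|by move=> [Ew _]; right].
  by move=> Ew; have [Uw|nU] := pselect (U a k j w); [left|right].
have mD : measurable (E a (k + j)%N `\` U a k j) by exact: measurableD.
have CE : ~` U a k j = (E a (k + j)%N `\` U a k j) `|` ~` U a k j.+1.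
  apply/seteqP; split => w; rewrite UE.
    move=> nU; have [Ew|nE] := pselect (E a (k + j)%N w); [by left|right].
    by move=> [/nU|[/nE]].
  by move=> [[]//|nU Uw]; apply: nU; left.
have i1 := integ_cst P (1 : R).
have -> : Eon P (~` U a k j) (V (k + j)%N) =
    Eon P (E a (k + j)%N `\` U a k j) (V (k + j)%N)
    + Eon P (~` U a k j.+1) (V (k + j)%N).
  rewrite {1}CE EonU //; apply/seteqP; split => // w [[Ew nU]].
  by rewrite UE; apply; right.
have -> : Eon P (U a k j.+1) (cst 1) =
    Eon P (U a k j) (cst 1) + Eon P (E a (k + j)%N `\` U a k j) (cst 1).
  rewrite UE EonU //; apply/seteqP; split => // w [Uw [_]]; exact.
have h1 := hV (@sUC a k j); rewrite -addnS in h1.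
suff : a * Eon P (E a (k + j)%N `\` U a k j) (cst 1) <=
       Eon P (E a (k + j)%N `\` U a k j) (V (k + j)%N) by lra.
rewrite -EonZ //; apply: le_Rintegral => //.
- by apply: integS => //; exact: integZ.
- exact: integS.
- by move=> w [Ew _]; rewrite mulr1.
Qed.

(** The bound for finitely many times does not depend on their number; let it tend to infinity by
    continuity of P along increasing sets. *)
Lemma supermartingale_sup_le a k : 0 < a ->
  (P (\bigcup_i E a (k + i)%N) <= ((Eon P setT (V k) + tau k) / a)%:E)%E.
Proof.
move=> a0.
have mU j : measurable (U a k j) by exact: GT (@sU a k j).
have Ub j : U a k j = \bigcup_(i in `I_j) E a (k + i)%N.
  by rewrite (bigcup_mkord j (fun i => E a (k + i)%N)).
have -> : \bigcup_i E a (k + i)%N = \bigcup_j U a k j.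
  apply/seteqP; split => w [i _].
    by move=> Ew; exists i.+1 => //; rewrite Ub; exists i => /=.
  by rewrite Ub => -[j _ Ew]; exists j.
have mb : measurable (\bigcup_j U a k j) by exact: bigcupT_measurable.
have nd : nondecreasing_seq (U a k).
  move=> m n mn; apply/subsetPset; rewrite !Ub.
  by move=> w [i im Ew]; exists i => //=; apply: leq_trans mn.
have cv := nondecreasing_cvg_mu (mu := P) mU mb nd.
rewrite -(cvg_lim _ cv) //; apply: lime_le; first by apply/cvg_ex; eexists; exact: cv.
apply: nearW => j /=.
have := @supermartingale_maximal a k j (ltW a0).
have := Eon_ge0 P (~` U a k j) (V0 (k + j)%N); have := tau0 (k + j)%N.
rewrite Eon_cst // mul1r -[X in (X <= _)%E](@fineK _ (P (U a k j))) ?fin_num_measure //.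
rewrite lee_fin ler_pdivlMr // mulrC; lra.
Qed.

(** For a fixed level, exceeding it infinitely often implies exceeding it after time k, which has
    arbitrarily small probability for suitable k. The levels 1 / (m + 1) give a countable union of
    null sets. *)
Lemma ae_cvg0 :
  (forall e, 0 < e -> exists k, Eon P setT (V k) + tau k <= e) ->
  {ae P, forall w, V ^~ w @ \oo --> (0 : R)}.
Proof.
move=> Vto0.
pose N m := \bigcap_k \bigcup_i E m.+1%:R^-1 (k + i)%N.
have negN m : P.-negligible (N m).
  have a0 : 0 < m.+1%:R^-1 :> R by rewrite invr_gt0.
  have mB k : measurable (\bigcup_i E m.+1%:R^-1 (k + i)%N).
    by apply: bigcupT_measurable => i; exact: GT (@sE _ _).
  have mN : measurable (N m) by exact: bigcapT_measurable.
  apply/negligibleP => //; apply/eqP; rewrite -measure_le0.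
  apply/lee_addgt0Pr => e e0; rewrite add0e.
  have [k hk] := Vto0 (e * m.+1%:R^-1) (mulr_gt0 e0 a0).
  apply: (@le_trans _ _ (P (\bigcup_i E m.+1%:R^-1 (k + i)%N))).
    by apply: le_measure; rewrite ?inE //; exact: bigcap_inf.
  apply: (le_trans (supermartingale_sup_le k a0)).
  by rewrite lee_fin ler_pdivrMr.
apply: negligibleS (negligible_bigcup negN) => w /= nV.
apply: contrapT => nN; apply: nV.
apply/cvgrPdist_lt => e e0.
pose m := Num.truncn e^-1.
have me : m.+1%:R^-1 < e.
  by rewrite invf_plt ?posrE // truncnS_gt.
have : ~ N m w by move=> Nw; apply: nN; exists m.
move=> nNw; have : (~` N m) w by [].
rewrite /N setC_bigcap => -[k _]; rewrite setC_bigcup => hk.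
exists k => // n /= kn; rewrite sub0r normrN ger0_norm //.
apply: (lt_trans _ me); rewrite ltNge; apply/negP.
by have := hk (n - k)%N I; rewrite /E /= subnKC.
Qed.

End maximal_inequality.

(** * One step of the iteration *)

Section unbiased_estimates.
Context (R : realType) (d : measure_display) (T : measurableType d).
Variables (P : probability T R) (G : set (set T)).
Hypothesis GT : <<s G >> `<=` measurable.

(** Replacing f by min (f, c), which is almost everywhere equal to it, turns the bound into a
    pointwise one. *)
Lemma Eon_ae_le (f : T -> R) c A : measurable A -> integ P f ->
  {ae P, forall w, f w <= c} -> Eon P A f <= c * Eon P A (cst 1).
Proof.
move=> mA iF fc; pose g w := Num.min (f w) c.
have mg : measurable_fun setT g.
  by apply: measurable_minr => //; exact: integ_measurable iF.
have ig : integ P g.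
  apply: (integ_le mg (integD (integ_abs iF) (integ_cst P `|c|))) => w.
  rewrite /g /Num.min /=; case: ifP => _; first by rewrite lerDl.
  by rewrite lerDr.
have -> : Eon P A f = Eon P A g.
  congr fine; apply: ae_eq_integral => //.
  - by apply/measurable_EFinP; apply: measurable_funTS; exact: integ_measurable iF.
  - by apply/measurable_EFinP; exact: measurable_funTS.
  - by apply: filterS fc => w wc _; rewrite /g /= min_l.
have <- : Eon P A (cst c) = c * Eon P A (cst 1) by rewrite !Eon_cst // mul1r.
by apply: Eon_le => // [|w]; [exact: integ_cst|rewrite /g ge_min lexx orbT].
Qed.

(** Passes from norms to entries; [hn] covers both [opnorm] and [enorm]. *)
Lemma centered_unbiased m n (nrm : 'M[R]_(m, n) -> R) c X mu i j :
  (forall A : 'M[R]_(m, n), A i j ^+ 2 <= nrm A ^+ 2) ->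
  unbiased_bounded P <<s G >> nrm c X mu ->
  centered P G c (fun w => X w i j - mu i j).
Proof.
move=> hn [/(_ i j) [iX _ _ eX] [Z [[iN iZ _ eN] Zc]]].
have iD : integ P (fun w => X w i j - mu i j).
  exact: (integD iX (integ_cst P (- mu i j))).
have iXX : integ P (fun w => (X w i j - mu i j) ^+ 2).
  apply: (integ_le _ iN) => [|w].
    by apply: measurable_funX; exact: integ_measurable iD.
  rewrite ger0_norm ?sqr_ge0 //; have := hn (X w - mu).
  by rewrite !mxE.
split.
- by split => //; exact: integ_measurable iD.
- move=> A sA; have mA := GT sA.
  have := eX A sA; rewrite !EonE //; last exact: integ_cst.
  move=> [e]; rewrite EonD // ?e; last exact: integ_cst.
  by rewrite !Eon_cst // mulNr subrr.
- move=> A sA; have mA := GT sA; apply: le_trans (Eon_ae_le mA iZ Zc).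
  have := eN A sA; rewrite !EonE // => -[<-].
  apply: Eon_le => // w; have := hn (X w - mu).
  by rewrite !mxE.
Qed.

(** Tested on the whole space, the variance bound reveals the sign of c. *)
Lemma centered_ge0 c X : centered P G c X -> 0 <= c.
Proof.
move=> [_ _ /(_ setT)]; rewrite Eon_cst // mul1r probability_setT /= mulr1 => h.
apply: le_trans (h _); first by apply: Eon_ge0 => w; exact: sqr_ge0.
exact: (@measurableT _ (g_sigma_algebraType G)).
Qed.

Lemma noisy_le H C C' (m : T -> R) : (forall w, 0 <= H w) -> C <= C' ->
  noisy P G H C m -> noisy P G H C' m.
Proof.
move=> H0 CC [L e h]; split => // A sA; apply: (le_trans (h A sA)).
by rewrite ler_wpM2r // Eon_ge0.
Qed.

End unbiased_estimates.

Lemma enorm_sqr (R : realType) n (v : 'cV[R]_n) : enorm v ^+ 2 = dot v v.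
Proof.
rewrite /enorm dotE sqr_sqrtr; last by rewrite sumr_ge0 // => i _; rewrite sqr_ge0.
by apply: eq_bigr => i _; rewrite expr2.
Qed.

Lemma enorm_ge0 (R : realType) n (v : 'cV[R]_n) : 0 <= enorm v.
Proof. exact: sqrtr_ge0. Qed.

(** The entry is a coordinate of A e_j, and e_j is a unit vector. *)
Lemma entry_le_opnorm (R : realType) m n (A : 'M[R]_(m, n)) i j :
  A i j ^+ 2 <= opnorm A ^+ 2.
Proof.
have [C C0 hC] := mulmx_bound A.
(* A supremum dominates the members of the set only once the set is known to be bounded. The bound 1
   + C works because C <= (1 + C)^2. *)
have hs : has_ubound [set enorm (A *m v) | v in [set v : 'cV[R]_n | enorm v <= 1]].
  exists (1 + C) => _ [v /= v1 <-].
  rewrite -(@ler_sqr _ (enorm (A *m v))) ?nnegrE ?enorm_ge0 //; last by lra.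
  rewrite enorm_sqr (le_trans (hC v)) // -enorm_sqr.
  have : enorm v ^+ 2 <= 1 by rewrite expr_le1 // enorm_ge0.
  rewrite -(ler_pM2l C0); nra.
pose e : 'cV[R]_n := delta_mx j ord0.
have e1 : enorm e <= 1.
  rewrite /enorm (bigD1 j) //= big1 => [|k /negPf kj].
    by rewrite mxE !eqxx expr1n addr0 sqrtr1.
  by rewrite mxE kj expr0n.
have hA : enorm (A *m e) <= opnorm A by apply: (ub_le_sup hs); exists e.
apply: (@le_trans _ _ (enorm (A *m e) ^+ 2)).
  rewrite enorm_sqr; have := dot_entry_le (A *m e) i.
  by rewrite -colE mxE.
by rewrite ler_sqr ?nnegrE ?enorm_ge0 // (le_trans _ hA) ?enorm_ge0.
Qed.

Lemma entry_le_enorm (R : realType) n (v : 'cV[R]_n) i j :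
  v i j ^+ 2 <= enorm v ^+ 2.
Proof. by rewrite enorm_sqr (ord1 j) dot_entry_le. Qed.

(** * Random vectors, coordinate by coordinate *)

Section random_vectors.
Context (R : realType) (d : measure_display) (T : measurableType d).
Variables (P : probability T R) (G : set (set T)).
Hypothesis GT : <<s G >> `<=` measurable.

Definition vL2 n (X : T -> 'cV[R]_n) : Prop := forall i, L2 P (fun w => X w i ord0).

Definition vsubmeas n (X : T -> 'cV[R]_n) : Prop :=
  forall i, submeas G (fun w => X w i ord0).

Definition vnoisy (H : T -> R) C n (X : T -> 'cV[R]_n) : Prop :=
  forall i, noisy P G H C (fun w => X w i ord0).

Lemma vL2D n (X Y : T -> 'cV[R]_n) : vL2 X -> vL2 Y -> vL2 (fun w => X w + Y w).
Proof. by move=> hX hY i; under eq_fun do rewrite mxE; exact: L2D. Qed.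

Lemma vL2Z n c (X : T -> 'cV[R]_n) : vL2 X -> vL2 (fun w => c *: X w).
Proof. by move=> hX i; under eq_fun do rewrite mxE; exact: L2Z. Qed.

Lemma vL2_cst n (v : 'cV[R]_n) : vL2 (cst v).
Proof. by move=> i; exact: L2_cst. Qed.

Lemma vL2_mulmx n m (A : 'M[R]_(m, n)) (X : T -> 'cV[R]_n) :
  vL2 X -> vL2 (fun w => A *m X w).
Proof.
move=> hX i; under eq_fun do rewrite mxE.
by apply: L2_sum => j; exact: L2Z.
Qed.

Lemma vsubmeasD n (X Y : T -> 'cV[R]_n) :
  vsubmeas X -> vsubmeas Y -> vsubmeas (fun w => X w + Y w).
Proof. by move=> hX hY i; under eq_fun do rewrite mxE; exact: submeasD. Qed.

Lemma vsubmeasZ n c (X : T -> 'cV[R]_n) : vsubmeas X -> vsubmeas (fun w => c *: X w).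
Proof.
move=> hX i; under eq_fun do rewrite mxE.
exact: submeasM (submeas_cst c) (hX i).
Qed.

Lemma vsubmeas_cst n (v : 'cV[R]_n) : vsubmeas (cst v).
Proof. by move=> i; exact: submeas_cst. Qed.

Lemma vsubmeas_mulmx n m (A : 'M[R]_(m, n)) (X : T -> 'cV[R]_n) :
  vsubmeas X -> vsubmeas (fun w => A *m X w).
Proof.
move=> hX i; under eq_fun do rewrite mxE.
by apply: submeas_sum => j; exact: (submeasM (submeas_cst (A i j)) (hX j)).
Qed.

Lemma integ_dot n (X Y : T -> 'cV[R]_n) : vL2 X -> vL2 Y ->
  integ P (fun w => dot (X w) (Y w)).
Proof.
move=> hX hY; under eq_fun do rewrite dotE.
by apply: integ_sum => i; exact: L2_mul.
Qed.

Lemma submeas_dot n (X Y : T -> 'cV[R]_n) : vsubmeas X -> vsubmeas Y ->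
  submeas G (fun w => dot (X w) (Y w)).
Proof.
move=> hX hY; under eq_fun do rewrite dotE.
by apply: submeas_sum => i; exact: submeasM.
Qed.

Lemma vnoisy_L2 H C n (X : T -> 'cV[R]_n) : vnoisy H C X -> vL2 X.
Proof. by move=> hX i; have [] := hX i. Qed.

Lemma vnoisy_orthogonal H C n (a X : T -> 'cV[R]_n) A :
  vsubmeas a -> vL2 a -> vnoisy H C X -> <<s G >> A ->
  Eon P A (fun w => dot (a w) (X w)) = 0.
Proof.
move=> ma La hX sA; under [X in Eon P A X]eq_fun do rewrite dotE.
rewrite Eon_sum => [|//|i]; [|exact: GT|by apply: L2_mul => //; exact: vnoisy_L2 hX i].
by rewrite big1 // => i _; have [_ e _] := hX i; exact: e.
Qed.

Lemma vnoisy_bound H C n (X : T -> 'cV[R]_n) A : vnoisy H C X -> <<s G >> A ->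
  Eon P A (fun w => dot (X w) (X w)) <= n%:R * C * Eon P A H.
Proof.
move=> hX sA; under [X in Eon P A X]eq_fun do rewrite dotE.
have LX := vnoisy_L2 hX.
rewrite Eon_sum; [|exact: GT|by move=> i; exact: L2_mul].
apply: (@le_trans _ _ (\sum_(i < n) C * Eon P A H)).
  apply: ler_sum => i _; have [_ _ h] := hX i.
  by under [X in Eon P A X]eq_fun do rewrite -expr2; exact: h.
by rewrite sumr_const card_ord -mulrA mulr_natl.
Qed.

End random_vectors.

Section expected_steps.
Context (R : realType) (d : measure_display) (T : measurableType d).
Variables (P : probability T R) (G : set (set T)).
Hypothesis GT : <<s G >> `<=` measurable.

(** Here q is the noiseless step, known given G. In the expansion of the form, the cross terms pair
    the noise with the known vectors L q and B^T L q and integrate to 0; the pure noise part is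
    bounded by K and [vnoisy_bound]. *)
Lemma expected_step (A : set T) m n (K CN a b : R) (L : 'M[R]_m) (B : 'M[R]_(m, n))
  (q N : T -> 'cV[R]_m) (N' : T -> 'cV[R]_n) (H f : T -> R) (C0 : R) :
  <<s G >> A -> L^T = L -> 0 <= CN -> integ P H -> (forall w, 0 <= H w) ->
  0 <= C0 -> (forall v : 'cV[R]_m, dot v (L *m v) <= K * dot v v) -> 0 <= K ->
  (forall v : 'cV[R]_n, dot (B *m v) (B *m v) <= C0 * dot v v) ->
  vL2 P q -> vsubmeas G q -> vnoisy P G H CN N -> vnoisy P G H CN N' ->
  (forall w, f w = dot (q w + a *: N w + b *: (B *m N' w))
                       (L *m (q w + a *: N w + b *: (B *m N' w)))) ->
  Eon P A f <= Eon P A (fun w => dot (q w) (L *m q w))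
    + (2 * K * m%:R * CN * a ^+ 2 + 2 * K * C0 * n%:R * CN * b ^+ 2) * Eon P A H.
Proof.
move=> sA Lsym CN0 iH H0 C00 hL K0 hB Lq mq hN hN' fE.
have mA := GT sA; have LN := vnoisy_L2 hN; have LN' := vnoisy_L2 hN'.
have LLq := vL2_mulmx L Lq; have LBq := vL2_mulmx B^T LLq.
have mLq := vsubmeas_mulmx L mq; have mBq := vsubmeas_mulmx B^T mLq.
have [r rE] : exists r : T -> 'cV[R]_m, r = fun w => a *: N w + b *: (B *m N' w).
  by eexists.
have fE' w : f w = dot (q w) (L *m q w) + 2 * a * dot (L *m q w) (N w)
    + 2 * b * dot (B^T *m (L *m q w)) (N' w) + dot (r w) (L *m r w).
  have -> : f w = dot (q w + r w) (L *m (q w + r w)) by rewrite fE rE addrA.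
  rewrite mulmxDr !dotDl !dotDr.
  have -> : dot (q w) (L *m r w) = dot (L *m q w) (r w) by rewrite dot_mulmxr Lsym.
  rewrite (dotC (r w) (L *m q w)) -(dot_mulmxr B) (_ : dot (L *m q w) (r w) =
    a * dot (L *m q w) (N w) + b * dot (L *m q w) (B *m N' w)); last first.
    by rewrite rE dotDr !dotZr.
  ring.
have fr w : f w <= dot (q w) (L *m q w) + 2 * a * dot (L *m q w) (N w)
    + 2 * b * dot (B^T *m (L *m q w)) (N' w)
    + (2 * K * a ^+ 2 * dot (N w) (N w) + 2 * K * C0 * b ^+ 2 * dot (N' w) (N' w)).
  rewrite fE' lerD2l (le_trans (hL _)) //.
  have := ler_wpM2l K0 (dotD_le (a *: N w) (b *: (B *m N' w))); rewrite rE.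
  have b2 := sqr_ge0 b; have := ler_wpM2l (mulr_ge0 K0 b2) (hB (N' w)).
  rewrite !dotZl !dotZr; lra.
have Lr : vL2 P r by rewrite rE; apply: vL2D; apply: vL2Z => //; exact: vL2_mulmx.
have i1 : integ P (fun w => dot (q w) (L *m q w)) by exact: integ_dot.
have i2 : integ P (fun w => dot (L *m q w) (N w)) by exact: integ_dot.
have i3 : integ P (fun w => dot (B^T *m (L *m q w)) (N' w)) by exact: integ_dot.
have i4 : integ P (fun w => dot (N w) (N w)) by exact: integ_dot.
have i5 : integ P (fun w => dot (N' w) (N' w)) by exact: integ_dot.
have i6 : integ P (fun w => dot (r w) (L *m r w)).
  by apply: integ_dot => //; exact: vL2_mulmx.
have i2' := integZ (2 * a) i2; have i3' := integZ (2 * b) i3.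
have i4' := integZ (2 * K * a ^+ 2) i4; have i5' := integZ (2 * K * C0 * b ^+ 2) i5.
have i12 := integD i1 i2'; have i123 := integD i12 i3'; have i45 := integD i4' i5'.
have iF : integ P f.
  by rewrite (funext fE'); exact: integD.
apply: (le_trans (Eon_le mA iF (integD i123 i45) fr)).
rewrite EonD // EonD // EonD // EonZ // EonZ // EonD // EonZ // EonZ //.
rewrite (vnoisy_orthogonal GT mLq LLq hN sA) (vnoisy_orthogonal GT mBq LBq hN' sA).
rewrite !mulr0 !addr0 lerD2l mulrDl.
have a2 := sqr_ge0 a; have b2 := sqr_ge0 b.
have k1 : 0 <= 2 * K * a ^+ 2 by rewrite mulr_ge0 // mulr_ge0.
have k2 : 0 <= 2 * K * C0 * b ^+ 2 by rewrite mulr_ge0 // mulr_ge0 // mulr_ge0.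
have := ler_wpM2l k1 (vnoisy_bound GT hN sA).
have := ler_wpM2l k2 (vnoisy_bound GT hN' sA); lra.
Qed.

End expected_steps.

Section recursions.
Context (R : realType) (d1 d2 : nat).
Variables (A : 'M[R]_d1) (A21 : 'M[R]_(d2, d1)) (B : 'M[R]_(d1, d2)) (D : 'M[R]_d2).
Variable CN : R.

(** All constants come before the sigma-algebra, the step sizes and the test set X. They are thus
    uniform in time, and X can be the whole space for the rates or any set of the filtration for the
    supermartingale. *)
Lemma expected_recursions :
  (forall v : 'cV_d1, v != 0 -> 0 < dot v (A *m v)) ->
  D^T = D -> (forall v : 'cV_d2, 0 <= dot v (D *m v)) -> 0 <= CN ->
  exists c c' C, [/\ 0 < c, 0 < c', 0 <= C &
  forall (d : measure_display) (T : measurableType d) (P : probability T R)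
    (G : set (set T)) (z z' : T -> 'cV[R]_d1) (u u' : T -> 'cV[R]_d2)
    (N : T -> 'cV[R]_d1) (N' : T -> 'cV[R]_d2) (a b : R) (X : set T),
  let H w := 1 + (dot (z w) (z w) + dot (u w) (u w)) in
  let S := a ^+ 2 + b ^+ 2 / a + b ^+ 2 in
  <<s G >> `<=` measurable -> 0 < a -> 0 < b ->
  vL2 P z -> vsubmeas G z -> vL2 P u -> vsubmeas G u ->
  vnoisy P G H CN N -> vnoisy P G H CN N' ->
  (forall w, z' w = z w - a *: (A *m z w) - b *: (B *m (A21 *m z w + D *m u w))
                    + a *: N w + b *: (B *m N' w)) ->
  (forall w, u' w = u w - b *: (A21 *m z w + D *m u w) + b *: N' w) ->
  <<s G >> X ->
  let EZ := Eon P X (fun w => dot (z w) (z w)) in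
  let EU := Eon P X (fun w => dot (u w) (u w)) in
  let EQ := Eon P X (fun w => dot (u w) (D *m u w)) in
  let W := Eon P X (cst 1) + (EZ + EU) in
  [/\ Eon P X (fun w => dot (z' w) (z' w)) <= (1 - c * a) * EZ + C * S * W,
      Eon P X (fun w => dot (u' w) (u' w)) <= EU + c * a * EZ + C * S * W &
      Eon P X (fun w => dot (u' w) (D *m u' w))
        <= (1 - c' * b) * EQ + C * b * EZ + C * b ^+ 2 * W]].
Proof.
move=> Apos Dsym Dpsd CN0.
have [c c0 hc] := posdefmx_coercive Apos.
have [K1 K10 hK1] := psd_form_le Dsym.
pose c' := K1^-1; have c'0 : 0 < c' by rewrite invr_gt0.
have hc' (v : 'cV_d2) : c' * dot v (D *m v) <= dot (D *m v) (D *m v).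
  by rewrite /c' ler_pdivrMl.
have [C1 C10 h1] := fast_step_bound (B *m A21) (B *m D) c0 hc.
have [C2 C20 h2] := slow_step_bound A21 c0 Dpsd.
have [C3 C30 h3] := form_step_bound A21 c'0 Dsym hc'.
have [CB CB0 hCB] := mulmx_bound B.
have [CD CD0 hCD] := mulmx_bound D.
have hD (v : 'cV_d2) : dot v (D *m v) <= (1 + CD) * dot v v.
  have := @dot_young _ _ 1 v (D *m v) ltr01.
  have := hCD v; have := dot_ge0 v; have := dot_ge0 (D *m v).
  by rewrite invr1 !mul1r; lra.
have hI n (v : 'cV[R]_n) : dot v (1%:M *m v) <= 1 * dot v v by rewrite mul1mx mul1r.
(* The step of u has a single noise term, so [expected_step] is used there with second matrix and
   second weight 0. *)
have h0 (v : 'cV[R]_d2) : dot ((0 : 'M[R]_d2) *m v) (0 *m v) <= 0 * dot v v.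
  by rewrite mul0mx /dot mulmx0 mxE mul0r.
pose X1 := 2 * 1 * d1%:R * CN; pose X2 := 2 * 1 * CB * d2%:R * CN.
pose X3 := 2 * 1 * d2%:R * CN; pose X4 := 2 * (1 + CD) * d2%:R * CN.
have X10 : 0 <= X1 by rewrite !mulr_ge0.
have X20 : 0 <= X2 by rewrite !mulr_ge0 // ltW.
have X30 : 0 <= X3 by rewrite !mulr_ge0.
have X40 : 0 <= X4 by rewrite !mulr_ge0 //; lra.
pose C := C1 + X1 + X2 + C2 + X3 + C3 + X4.
exists c, c', C; split => //; first by rewrite /C; clearbody X1 X2 X3 X4; lra.
move=> d T P G z z' u u' N N' a b X H S GT a0 b0 Lz mz Lu mu hN hN' z'E u'E sX EZ EU EQ W.
have mX := GT X sX.
have iz : integ P (fun w => dot (z w) (z w)) by exact: integ_dot.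
have iu : integ P (fun w => dot (u w) (u w)) by exact: integ_dot.
have iuD : integ P (fun w => dot (u w) (D *m u w)).
  by apply: integ_dot => //; exact: vL2_mulmx.
have izu := integD iz iu.
have iH : integ P H by exact: (integD (integ_cst P 1) izu).
have H0 w : 0 <= H w by rewrite /H !addr_ge0 ?dot_ge0.
have EH : Eon P X H = W by rewrite /H EonD //; [rewrite EonD|exact: integ_cst].
have EZ0 : 0 <= EZ by apply: Eon_ge0 => w; exact: dot_ge0.
have EU0 : 0 <= EU by apply: Eon_ge0 => w; exact: dot_ge0.
have p0 : 0 <= Eon P X (cst 1) by apply: Eon_ge0.
have WZU : EZ + EU <= W by rewrite /W lerDr.
have W0 : 0 <= W by rewrite (le_trans _ WZU) // addr_ge0.
have a2 : 0 <= a ^+ 2 by exact: sqr_ge0.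
have b2 : 0 <= b ^+ 2 by exact: sqr_ge0.
have ba : 0 <= b ^+ 2 / a by rewrite divr_ge0 // ltW.
have S0 : 0 <= S by rewrite /S !addr_ge0.
have aS : a ^+ 2 <= S by rewrite /S -addrA lerDl addr_ge0.
have bS : b ^+ 2 <= S by rewrite /S lerDr addr_ge0.
have baS : b ^+ 2 / a + b ^+ 2 <= S by rewrite /S -addrA lerDr.
pose g w := A21 *m z w + D *m u w.
have Lg : vL2 P g by exact: (vL2D (vL2_mulmx A21 Lz) (vL2_mulmx D Lu)).
have mg : vsubmeas G g by exact: (vsubmeasD (vsubmeas_mulmx A21 mz) (vsubmeas_mulmx D mu)).
pose q w := z w + (- a) *: (A *m z w) + (- b) *: (B *m g w).
pose r w := u w + (- b) *: g w.
have Lq : vL2 P q.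
  exact: (vL2D (vL2D Lz (vL2Z _ (vL2_mulmx A Lz))) (vL2Z _ (vL2_mulmx B Lg))).
have mq : vsubmeas G q.
  exact: (vsubmeasD (vsubmeasD mz (vsubmeasZ _ (vsubmeas_mulmx A mz)))
    (vsubmeasZ _ (vsubmeas_mulmx B mg))).
have Lr : vL2 P r by exact: (vL2D Lu (vL2Z _ Lg)).
have mr : vsubmeas G r by exact: (vsubmeasD mu (vsubmeasZ _ mg)).
have qE w : q w = z w - a *: (A *m z w) - b *: (B *m A21 *m z w + B *m D *m u w).
  by rewrite /q /g !scaleNr mulmxDr !mulmxA.
have rE w : r w = u w - b *: (A21 *m z w + D *m u w) by rewrite /r scaleNr.
have SW0 : 0 <= S * W by rewrite mulr_ge0.
have bW0 : 0 <= b ^+ 2 * W by rewrite mulr_ge0.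
have leS k t : 0 <= k -> 0 <= t -> t <= S -> k * t * W <= k * (S * W).
  by move=> k0 t0 tS; rewrite -mulrA ler_wpM2l // ler_wpM2r.
split.
- have s := @expected_step _ _ _ P G GT X d1 d2 1 CN a b 1%:M B q N N' H
    (fun w => dot (z' w) (z' w)) CB sX (trmx1 _ _)
    CN0 iH H0 (ltW CB0) (@hI _) ler01 hCB Lq mq hN hN'.
  apply: (le_trans (s _)) => [w|].
    by rewrite mul1mx z'E /q /g !scaleNr.
  rewrite EH -/X1 -/X2.
  have e1 : Eon P X (fun w => dot (q w) (1%:M *m q w)) <=
      Eon P X (fun w => (1 - c * a) * dot (z w) (z w)
        + C1 * S * (dot (z w) (z w) + dot (u w) (u w))).
    apply: Eon_le => //.
    - by apply: integ_dot => //; exact: vL2_mulmx.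
    - by apply: integD; exact: integZ.
    - by move=> w; rewrite mul1mx; exact: (h1 a b (z w) (q w) (u w) a0 (qE w)).
  rewrite EonD in e1; [|by []|exact: integZ|exact: integZ].
  rewrite !EonZ // EonD // -/EZ -/EU in e1.
  have l1 : C1 * S * (EZ + EU) <= C1 * (S * W) by rewrite -mulrA !ler_wpM2l // ltW.
  have l2 := leS X1 (a ^+ 2) X10 a2 aS; have l3 := leS X2 (b ^+ 2) X20 b2 bS.
  have l4 : (C1 + X1 + X2) * (S * W) <= C * (S * W).
    by rewrite ler_wpM2r // /C; clearbody X1 X2 X3 X4;
      clear -C10 X10 X20 C20 X30 C30 X40; lra.
  clearbody X1 X2 C S W EZ EU; move: e1 l1 l2 l3 l4; move: (Eon _ _ _).
  move=> q1; clear; lra.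
- have s := @expected_step _ _ _ P G GT X d2 d2 1 CN b 0 1%:M 0 r N' N' H
    (fun w => dot (u' w) (u' w)) 0 sX (trmx1 _ _)
    CN0 iH H0 (lexx 0) (@hI _) ler01 h0 Lr mr hN' hN'.
  apply: (le_trans (s _)) => [w|].
    by rewrite mul1mx u'E scale0r addr0 /r scaleNr.
  rewrite EH -/X3 expr0n /= mulr0 addr0.
  have e1 : Eon P X (fun w => dot (r w) (1%:M *m r w)) <=
      Eon P X (fun w => dot (u w) (u w) + c * a * dot (z w) (z w)
        + C2 * (b ^+ 2 / a + b ^+ 2) * (dot (z w) (z w) + dot (u w) (u w))).
    apply: Eon_le => //.
    - by apply: integ_dot => //; exact: vL2_mulmx.
    - by apply: integD; [apply: integD => //|]; exact: integZ.
    - by move=> w; rewrite mul1mx; exact: (h2 a b (z w) (u w) (r w) a0 (ltW b0) (rE w)).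
  rewrite EonD in e1; [|by []|by apply: integD => //; exact: integZ|exact: integZ].
  rewrite EonD // in e1; last exact: integZ.
  rewrite !EonZ // EonD // -/EZ -/EU in e1.
  have l1 : C2 * (b ^+ 2 / a + b ^+ 2) * (EZ + EU) <= C2 * (S * W).
    rewrite -mulrA ler_wpM2l ?(ltW C20) //; apply: ler_pM => //; rewrite addr_ge0 //.
  have l3 := leS X3 (b ^+ 2) X30 b2 bS.
  have l4 : (C2 + X3) * (S * W) <= C * (S * W).
    by rewrite ler_wpM2r // /C; clearbody X1 X2 X3 X4;
      clear -C10 X10 X20 C20 X30 C30 X40; lra.
  clearbody X3 C S W EZ EU; move: e1 l1 l3 l4; move: (Eon _ _ _).
  move=> q1; clear; lra.
- have s := @expected_step _ _ _ P G GT X d2 d2 (1 + CD) CN b 0 D 0 r N' N' H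
    (fun w => dot (u' w) (D *m u' w)) 0 sX Dsym CN0 iH H0 (lexx 0) hD
    (addr_ge0 ler01 (ltW CD0)) h0 Lr mr hN' hN'.
  apply: (le_trans (s _)) => [w|].
    by rewrite u'E scale0r addr0 /r scaleNr.
  rewrite EH -/X4 expr0n /= mulr0 addr0.
  have e1 : Eon P X (fun w => dot (r w) (D *m r w)) <=
      Eon P X (fun w => (1 - c' * b) * dot (u w) (D *m u w) + C3 * b * dot (z w) (z w)
        + C3 * b ^+ 2 * (dot (z w) (z w) + dot (u w) (u w))).
    apply: Eon_le => //.
    - by apply: integ_dot => //; exact: vL2_mulmx.
    - by apply: integD; [apply: integD|]; exact: integZ.
    - by move=> w; exact: (h3 b (z w) (u w) (r w) (ltW b0) (rE w)).
  rewrite EonD in e1; [|by []|by apply: integD; exact: integZ|exact: integZ].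
  rewrite EonD in e1; [|by []|exact: integZ|exact: integZ].
  rewrite !EonZ // EonD // -/EZ -/EU -/EQ in e1.
  have l1 : C3 * b ^+ 2 * (EZ + EU) <= C3 * (b ^+ 2 * W).
    by rewrite -mulrA !ler_wpM2l // ltW.
  have l2 : C3 * b * EZ <= C * b * EZ.
    rewrite ler_wpM2r // ler_wpM2r ?(ltW b0) // /C; clearbody X1 X2 X3 X4;
      clear -C10 X10 X20 C20 X30 C30 X40; lra.
  have l4 : (C3 + X4) * (b ^+ 2 * W) <= C * (b ^+ 2 * W).
    by rewrite ler_wpM2r // /C; clearbody X1 X2 X3 X4;
      clear -C10 X10 X20 C20 X30 C30 X40; lra.
  clearbody X4 C W EZ EU EQ; move: e1 l1 l2 l4; move: (Eon _ _ _).
  move=> q1; clear; lra.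
Qed.

End recursions.

(** * The linear iteration *)

(** A coordinate of the noise is a sum of 1 + d1 + d2 products of an entry error with 1 or a
    coordinate of an iterate, and [C0 * H] majorizes the square of each second factor. *)
Lemma noise_vnoisy (R : realType) (m d1 d2 : nat) (c C0 : R) : exists2 C, 0 <= C &
  forall (d : measure_display) (T : measurableType d) (P : probability T R)
    (G : set (set T)) (H : T -> R) (b : 'cV[R]_m) (A1 : 'M[R]_(m, d1))
    (A2 : 'M[R]_(m, d2)) (tb : nat -> T -> 'cV[R]_m)
    (tA1 : nat -> T -> 'M[R]_(m, d1)) (tA2 : nat -> T -> 'M[R]_(m, d2))
    (x : nat -> T -> 'cV[R]_d1) (y : nat -> T -> 'cV[R]_d2) (p : nat),
  <<s G >> `<=` measurable -> integ P H ->
  (forall w, 1 <= C0 * H w) -> (forall w, 0 <= H w) ->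
  (forall w, dot (x p w) (x p w) <= C0 * H w) ->
  (forall w, dot (y p w) (y p w) <= C0 * H w) ->
  vL2 P (x p) -> vsubmeas G (x p) -> vL2 P (y p) -> vsubmeas G (y p) ->
  unbiased_bounded P <<s G >> enorm c (tb p.+1) b ->
  unbiased_bounded P <<s G >> opnorm c (tA1 p.+1) A1 ->
  unbiased_bounded P <<s G >> opnorm c (tA2 p.+1) A2 ->
  vnoisy P G H C (noise b A1 A2 tb tA1 tA2 x y p).
Proof.
have [C1 h1] := noisy_sum (c * C0) d1; have [C2 h2] := noisy_sum (c * C0) d2.
pose C := 2 * (2 * (c * C0) + 2 * C1) + 2 * C2.
(* The signs of c and C0 are not fixed here, so C itself might be negative. *)
exists (Num.max 0 C); first by rewrite le_max lexx.
move=> d T P G H b A1 A2 tb tA1 tA2 x y p GT iH H1 H0 Hx Hy Lx mx Ly my ub uA1 uA2 i.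
apply: (@noisy_le _ _ _ _ _ _ C) => //; first by rewrite le_max lexx orbT.
rewrite (_ : (fun w => _) = fun w => ((tb p.+1 w i ord0 - b i ord0) * cst 1 w
    + - \sum_(j < d1) (tA1 p.+1 w i j - A1 i j) * x p w j ord0)
    + - \sum_(j < d2) (tA2 p.+1 w i j - A2 i j) * y p w j ord0); last first.
  apply/funext => w; rewrite /noise !mxE mulr1.
  congr (_ - _ - _); apply: eq_bigr => j _; by rewrite !mxE.
have cb := centered_unbiased GT (fun v => entry_le_enorm v i ord0) ub.
apply: noisyD => //; [apply: noisyD => //|].
- apply: (centered_noisy GT cb) => //.
  + exact: submeas_cst.
  + exact: L2_cst.
  + exact: centered_ge0 cb.
  + by move=> w; rewrite expr1n.
- apply: noisyN => //; apply: h1 => // j.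
  have cA := centered_unbiased GT (fun A => entry_le_opnorm A i j) uA1.
  apply: (centered_noisy GT cA) => //; first exact: centered_ge0 cA.
  by move=> w; apply: le_trans (Hx w); exact: dot_entry_le.
- apply: noisyN => //; apply: h2 => // j.
  have cA := centered_unbiased GT (fun A => entry_le_opnorm A i j) uA2.
  apply: (centered_noisy GT cA) => //; first exact: centered_ge0 cA.
  by move=> w; apply: le_trans (Hy w); exact: dot_entry_le.
Qed.

(** * Filtrations and initial data *)

Section filtrations.
Context (R : realType) (d : measure_display) (T : measurableType d).
Implicit Types (G : set (set T)).

Lemma submeasS G G' (f : T -> R) : <<s G >> `<=` <<s G' >> -> submeas G f -> submeas G' f.
Proof. by move=> GG mf _ B mB; apply: GG; exact: (mf measurableT B mB). Qed.

Lemma coord_preimages_vsubmeas G n (X : T -> 'cV[R]_n) :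
  coord_preimages X `<=` G -> vsubmeas G X.
Proof.
move=> XG j _ B mB; apply: sub_sigma_algebra; apply: XG.
by exists j => //; exists B.
Qed.

Lemma coord_preimages_measurable n (X : T -> 'cV[R]_n) :
  (forall j, measurable_fun setT (fun w => X w j ord0)) ->
  coord_preimages X `<=` measurable.
Proof. by move=> mX A [j _ [B mB <-]]; exact: mX. Qed.

Lemma Eon_le_setT (P : probability T R) (A : set T) (f : T -> R) :
  measurable A -> integ P f -> (forall w, 0 <= f w) -> Eon P A f <= Eon P setT f.
Proof.
move=> mA iF f0; rewrite -lee_fin -!EonE //.
apply: ge0_subset_integral => //; last by move=> w _; rewrite lee_fin.
by apply/measurable_EFinP; exact: integ_measurable iF.
Qed.

Lemma square_integrable_vL2 (P : probability T R) n (X : T -> 'cV[R]_n) :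
  square_integrable P X -> vL2 P X.
Proof.
move=> [mX iX] j; split => //.
have iE : integ P (fun w => enorm (X w) ^+ 2).
  apply/integrableP; split.
    apply/measurable_EFinP; under eq_fun do rewrite enorm_sqr dotE.
    by apply: measurable_sum => i; exact: measurable_funM.
  rewrite unlock in iX; apply: le_lt_trans iX.
  apply: ge0_le_integral => //=.
  - apply/measurable_EFinP; apply: measurableT_comp => //.
    under eq_fun do rewrite enorm_sqr dotE.
    by apply: measurable_sum => i; exact: measurable_funM.
  - apply/measurable_EFinP; under eq_fun do rewrite enorm_sqr dotE.
    by apply: measurable_sum => i; exact: measurable_funM.
  - by move=> w _; rewrite lee_fin ger0_norm // sqr_ge0.
apply: (integ_le _ iE) => [|w]; first exact: measurable_funX.
by rewrite ger0_norm ?sqr_ge0 // enorm_sqr dot_entry_le.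
Qed.

End filtrations.

Theorem corollary5p4 (R : realType) (d1 d2 : nat)
    (d : measure_display) (T : measurableType d) (P : probability T R)
    (A11 : 'M[R]_d1) (A12 : 'M[R]_(d1, d2))
    (A21 : 'M[R]_(d2, d1)) (A22 : 'M[R]_d2)
    (b1 : 'cV[R]_d1) (b2 : 'cV[R]_d2)
    (tA11 : nat -> T -> 'M[R]_d1) (tA12 : nat -> T -> 'M[R]_(d1, d2))
    (tA21 : nat -> T -> 'M[R]_(d2, d1)) (tA22 : nat -> T -> 'M[R]_d2)
    (tb1 : nat -> T -> 'cV[R]_d1) (tb2 : nat -> T -> 'cV[R]_d2)
    (x : nat -> T -> 'cV[R]_d1) (y : nat -> T -> 'cV[R]_d2)
    (alpha beta K1 eps c3 : R) :
  let alpha_ := stepsize alpha K1 (1 / 2 + 66 / 100 * eps) in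
  let beta_ := stepsize beta K1 (3 / 4 + eps) in
  let F := filtration (x 0%N) (y 0%N)
             (noise b1 A11 A12 tb1 tA11 tA12 x y)
             (noise b2 A21 A22 tb2 tA21 tA22 x y) in
  let Delta := schur A11 A12 A21 A22 in
  let xstar := fun v : 'cV[R]_d2 => invmx A11 *m (b1 - A12 *m v) in
  let Sol := solutions A11 A12 A21 A22 b1 b2 in
  0 < alpha -> 0 < beta -> 1 <= K1 -> 0 < eps -> eps < 1 / 4 ->
  square_integrable P (x 0%N) -> square_integrable P (y 0%N) ->
  (forall k w, x k.+1 w = x k w + alpha_ k *:
     (tb1 k.+1 w - tA11 k.+1 w *m x k w - tA12 k.+1 w *m y k w)) ->
  (forall k w, y k.+1 w = y k w + beta_ k *:
     (tb2 k.+1 w - tA21 k.+1 w *m x k w - tA22 k.+1 w *m y k w)) ->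
  (* [negsemidefmx] does not include symmetry *)
  negdefmx (- A11) ->
  Delta^T = Delta -> negsemidefmx (- Delta) -> Delta != 0 ->
  Sol !=set0 ->
  (forall k,
     [/\ unbiased_bounded P (F k) opnorm c3 (tA11 k.+1) A11,
         unbiased_bounded P (F k) opnorm c3 (tA12 k.+1) A12,
         unbiased_bounded P (F k) opnorm c3 (tA21 k.+1) A21 &
         unbiased_bounded P (F k) opnorm c3 (tA22 k.+1) A22] /\
     (unbiased_bounded P (F k) enorm c3 (tb1 k.+1) b1 /\
      unbiased_bounded P (F k) enorm c3 (tb2 k.+1) b2)) ->
  [/\ {ae P, forall w, dist_set Sol (x k w) (y k w) @[k --> \oo] --> (0 : R)},
      exists C : R, forall k : nat, (0 < k)%N ->
        ('E_P[fun w => (enorm (x k w - xstar (y k w)) ^+ 2)%R]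
           <= (C / k%:R `^ (1 / 2))%:E)%E &
      exists C : R, forall k : nat, (0 < k)%N ->
        ('E_P[fun w => (enorm (A21 *m x k w + A22 *m y k w - b2) ^+ 2)%R]
           <= (C / k%:R `^ (1 / 4 - eps))%:E)%E].
Proof.
move=> al be F Delta xstar Sol alpha0 beta0 K1_ge1 eps0 eps4 Lx0 Ly0 xE yE Aneg
  Dsym Dneg _ [[xs ys] [/= s1 s2]] hyp.
have Apos (v : 'cV_d1) : v != 0 -> 0 < dot v (A11 *m v).
  move=> /Aneg; rewrite mulmxN mulNmx mxE oppr_lt0 -mulmxA; exact.
have Dpsd (v : 'cV_d2) : 0 <= dot v (Delta *m v).
  by have := Dneg v; rewrite mulmxN mulNmx mxE oppr_le0 -mulmxA.
have A11u : A11 \in unitmx := posdefmx_unit Apos.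
pose B := invmx A11 *m A12.
pose u k w := y k w - ys; pose z k w := x k w - xstar (y k w).
pose N := noise b1 A11 A12 tb1 tA11 tA12 x y.
pose N' := noise b2 A21 A22 tb2 tA21 tA22 x y.
have xstarE v : xstar v = xs - B *m (v - ys).
  rewrite /xstar -s1 -addrA -mulmxBr -(opprB v ys) mulmxDr mulKmx //.
  by rewrite !mulmxN mulmxA.
have zE k : z k = fun w => x k w + cst (- xs) w + B *m u k w.
  by apply/funext => w; rewrite /z xstarE opprB (addrC (B *m _)) addrA.
have A11z k w : A11 *m z k w = A11 *m x k w + A12 *m y k w - b1.
  by rewrite /z mulmxBr mulKVmx // opprB addrA.
have DE (v : 'cV_d2) : Delta *m v = A22 *m v - A21 *m (B *m v).
  by rewrite /Delta /schur mulmxBl /B !mulmxA.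
have res k w : A21 *m x k w + A22 *m y k w - b2 = A21 *m z k w + Delta *m u k w.
  rewrite zE /= DE -s2 mulmxDr [A21 *m (_ + _)]mulmxDr mulmxN /u [A22 *m (_ - _)]mulmxBr.
  by rewrite [RHS]addrACA subrr addr0 opprD addrACA.
(* Hence (xstar v, v) is a solution exactly when v - ys lies in the kernel of Delta, which provides
   nearby solutions at the end. *)
have resx v : A21 *m xstar v + A22 *m v - b2 = Delta *m (v - ys).
  rewrite xstarE DE -s2 mulmxDr mulmxN [A22 *m (_ - _)]mulmxBr.
  move: (A21 *m xs) (A21 *m _) (A22 *m v) (A22 *m ys) => v1 v2 v3 v4.
  by apply/matrixP => i j; rewrite !mxE; ring.
have xE' k w : x k.+1 w = x k w + al k *: (N k w - A11 *m z k w).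
  rewrite xE A11z /N /noise !mulmxBl; congr (_ + _ *: _).
  move: (tA11 k.+1 w *m x k w) (A11 *m x k w) (tA12 k.+1 w *m y k w) (A12 *m y k w).
  by move=> v1 v2 v3 v4; apply/matrixP => i j; rewrite !mxE; ring.
have uE k w : u k.+1 w = u k w - be k *: (A21 *m z k w + Delta *m u k w) + be k *: N' k w.
  rewrite -res /u yE /N' /noise !mulmxBl.
  move: (tA21 k.+1 w *m x k w) (A21 *m x k w) (tA22 k.+1 w *m y k w) (A22 *m y k w).
  by move=> v1 v2 v3 v4; apply/matrixP => i j; rewrite !mxE; ring.
have zE' k w : z k.+1 w = z k w - al k *: (A11 *m z k w)
    - be k *: (B *m (A21 *m z k w + Delta *m u k w)) + al k *: N k w + be k *: (B *m N' k w).
  move: (uE k w) (xE' k w); rewrite (zE k.+1).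
  move: (A21 *m z k w + Delta *m u k w) (A11 *m z k w) => g h; rewrite (zE k) /=.
  move: (u k w) (u k.+1 w) (N k w) (N' k w) (x k w) (x k.+1 w).
  move=> u0 u1 n n' x0 x1 -> ->; rewrite !mulmxDr mulmxN -!scalemxAr.
  move: (B *m u0) (B *m g) (B *m n') => v1 v2 v3.
  by apply/matrixP => i j; rewrite !mxE; ring.
have al_gt0 k : 0 < al k by exact: stepsize_gt0.
have be_gt0 k : 0 < be k by exact: stepsize_gt0.
pose H k w := 1 + (dot (z k w) (z k w) + dot (u k w) (u k w)).
have H1 k w : 1 <= H k w by rewrite lerDl addr_ge0 ?dot_ge0.
have [CB CB0 hCB] := mulmx_bound B.
(* Read off from x = z + (xs - B u) and y = u + ys with |v + w|^2 <= 2 |v|^2 + 2 |w|^2; the 1 in H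
   accounts for xs and ys. *)
pose C0 := 2 + 4 * dot xs xs + 4 * CB + 2 * dot ys ys.
have [xs0 ys0] := (dot_ge0 xs, dot_ge0 ys).
have C01 : 1 <= C0 by clear -xs0 ys0 CB0; rewrite /C0; lra.
have hx k w : dot (x k w) (x k w) <= C0 * H k w.
  have -> : x k w = z k w + (xs - B *m u k w).
    by rewrite zE /=; apply/matrixP => i j; rewrite !mxE; ring.
  have := dotD_le (z k w) (xs - B *m u k w); have := dotD_le xs (- (B *m u k w)).
  have := hCB (u k w); rewrite !(dotNl, dotNr) opprK => p1 p2 p3.
  have := dot_ge0 (z k w); have := dot_ge0 (u k w); rewrite /H /C0.
  move: (dot (z k w) (z k w)) (dot (u k w) (u k w)) p1 p2 p3 => Z U p1 p2 p3 U0 Z0.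
  have := mulr_ge0 xs0 U0; have := mulr_ge0 xs0 Z0; have := mulr_ge0 ys0 U0.
  have := mulr_ge0 ys0 Z0; have := mulr_ge0 (ltW CB0) Z0; lra.
have hy k w : dot (y k w) (y k w) <= C0 * H k w.
  have -> : y k w = u k w + ys by rewrite subrK.
  have := dotD_le (u k w) ys.
  have := dot_ge0 (z k w); have := dot_ge0 (u k w); rewrite /H /C0.
  move: (dot (z k w) (z k w)) (dot (u k w) (u k w)) => Z U U0 Z0.
  have := mulr_ge0 xs0 U0; have := mulr_ge0 xs0 Z0; have := mulr_ge0 ys0 U0.
  have := mulr_ge0 ys0 Z0; have := mulr_ge0 (ltW CB0) Z0; have := mulr_ge0 (ltW CB0) U0; lra.
have H0 k w : 0 <= H k w by rewrite (le_trans _ (H1 k w)).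
have HC k w : 1 <= C0 * H k w by rewrite (le_trans (H1 k w)) // ler_peMl.
have [CN1 CN10 hN1] := noise_vnoisy d1 d1 d2 c3 C0.
have [CN2 CN20 hN2] := noise_vnoisy d2 d1 d2 c3 C0.
pose CN := Num.max CN1 CN2.
have CN0 : 0 <= CN by rewrite le_max CN10.
(* These are the generators of the filtration: [F k] is [<<s G k >>] by definition. *)
pose G k := coord_preimages (x 0%N) `|` coord_preimages (y 0%N) `|`
  \bigcup_(p in [set p : nat | (p < k)%N])
    (coord_preimages (N p) `|` coord_preimages (N' p)).
have GS k : G k `<=` G k.+1.
  move=> X [?|[p /= pk ?]]; [by left|right].
  by exists p => //=; exact: ltnW.
have sGS k : <<s G k >> `<=` <<s G k.+1 >> by exact: sub_sigma_algebra2.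
(* One induction is needed for all of this: [G k.+1] contains preimages under the noise of index k,
   whose measurability follows from its square integrability, which in turn rests on the iterates
   being square integrable and adapted at time k. *)
pose Inv k := [/\ G k `<=` measurable, vL2 P (x k), vL2 P (y k),
  vsubmeas (G k) (x k) & vsubmeas (G k) (y k)].
have sGT k : Inv k -> <<s G k >> `<=` measurable.
  by move=> [GT _ _ _ _]; apply: smallest_sub => //; exact: sigma_algebra_measurable.
have zu k : Inv k ->
    [/\ vL2 P (z k), vsubmeas (G k) (z k), vL2 P (u k) & vsubmeas (G k) (u k)].
  move=> [_ Lx Ly mx my].
  have Lu : vL2 P (u k) by exact: (vL2D Ly (vL2_cst P (- ys))).
  have mu : vsubmeas (G k) (u k) by exact: (vsubmeasD my (vsubmeas_cst (- ys))).
  rewrite zE; split => //.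
    exact: (vL2D (vL2D Lx (vL2_cst P (- xs))) (vL2_mulmx B Lu)).
  exact: (vsubmeasD (vsubmeasD mx (vsubmeas_cst (- xs))) (vsubmeas_mulmx B mu)).
have noiseP k : Inv k -> vnoisy P (G k) (H k) CN (N k) /\ vnoisy P (G k) (H k) CN (N' k).
  move=> hk; have [Lz mz Lu mu] := zu k hk; have GT := sGT k hk.
  have [_ Lx Ly mx my] := hk.
  have iH : integ P (H k).
    by apply: (integD (integ_cst P 1)); apply: integD; exact: integ_dot.
  have [[uA11 uA12 uA21 uA22] [ub1 ub2]] := hyp k.
  split=> i.
    apply: (@noisy_le _ _ _ _ _ _ CN1) => //; first by rewrite le_max lexx.
    exact: (hN1 _ _ _ _ _ _ _ _ _ _ _ _ _ _ GT iH (HC k) (H0 k) (hx k) (hy k)).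
  apply: (@noisy_le _ _ _ _ _ _ CN2) => //; first by rewrite le_max lexx orbT.
  exact: (hN2 _ _ _ _ _ _ _ _ _ _ _ _ _ _ GT iH (HC k) (H0 k) (hx k) (hy k)).
have inv k : Inv k.
  elim: k => [|k IH].
    have Gx : coord_preimages (x 0%N) `<=` G 0%N by move=> X ?; left; left.
    have Gy : coord_preimages (y 0%N) `<=` G 0%N by move=> X ?; left; right.
    split; try exact: square_integrable_vL2; try exact: coord_preimages_vsubmeas.
    move=> X [[|]|[p] //]; apply: coord_preimages_measurable.
      exact: (proj1 Lx0).
    exact: (proj1 Ly0).
  have [hN hN'] := noiseP k IH; have [Lz mz Lu mu] := zu k IH.
  have [GT Lx Ly mx my] := IH.
  have LN := vnoisy_L2 hN; have LN' := vnoisy_L2 hN'.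
  have mN : vsubmeas (G k.+1) (N k).
    by apply: coord_preimages_vsubmeas => X ?; right; exists k => /=; [exact: ltnSn|left].
  have mN' : vsubmeas (G k.+1) (N' k).
    by apply: coord_preimages_vsubmeas => X ?; right; exists k => /=; [exact: ltnSn|right].
  have mS n (X : T -> 'cV[R]_n) : vsubmeas (G k) X -> vsubmeas (G k.+1) X.
    by move=> mX i; exact: (submeasS (sGS k) (mX i)).
  (* Written with the noise instead of the estimates, the next iterate is a deterministic
     combination of functions measurable for [G k.+1]; the estimates themselves need not be. *)
  have xS : x k.+1 = fun w => x k w + al k *: (N k w + (-1) *: (A11 *m z k w)).
    by apply/funext => w; rewrite xE' scaleN1r.
  have yS : y k.+1 = fun w => (u k w + (- be k) *: (A21 *m z k w + Delta *m u k w)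
      + be k *: N' k w) + cst ys w.
    by apply/funext => w; rewrite scaleNr -uE subrK.
  have mz' := mS _ _ mz; have mu' := mS _ _ mu.
  split.
  - move=> X [X0|[p /= pk]]; first by apply: GT; left.
    have [<-{p pk}|pk'] := eqVneq k p; last first.
      by move=> X0; apply: GT; right; exists p => //=; rewrite ltn_neqAle eq_sym pk'.
    by move=> [] X0; apply: coord_preimages_measurable X0 => j;
      [exact: (LN j).1|exact: (LN' j).1].
  - rewrite xS; exact: (vL2D Lx (vL2Z _ (vL2D LN (vL2Z _ (vL2_mulmx A11 Lz))))).
  - rewrite yS; exact: (vL2D (vL2D (vL2D Lu (vL2Z _ (vL2D (vL2_mulmx A21 Lz)
      (vL2_mulmx Delta Lu)))) (vL2Z _ LN')) (vL2_cst P ys)).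
  - rewrite xS; exact: (vsubmeasD (mS _ _ mx) (vsubmeasZ _ (vsubmeasD mN
      (vsubmeasZ _ (vsubmeas_mulmx A11 mz'))))).
  - rewrite yS; exact: (vsubmeasD (vsubmeasD (vsubmeasD mu' (vsubmeasZ _
      (vsubmeasD (vsubmeas_mulmx A21 mz') (vsubmeas_mulmx Delta mu')))) (vsubmeasZ _ mN'))
      (vsubmeas_cst ys)).
have [c [c' [C [c0 c'0 C0' hrec]]]] := expected_recursions A21 B Apos Dsym Dpsd CN0.
have GT k := sGT k (inv k).
have iZ k : integ P (fun w => dot (z k w) (z k w)).
  by have [Lz _ _ _] := zu k (inv k); exact: integ_dot.
have iU k : integ P (fun w => dot (u k w) (u k w)).
  by have [_ _ Lu _] := zu k (inv k); exact: integ_dot.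
have iQ k : integ P (fun w => dot (u k w) (Delta *m u k w)).
  by have [_ _ Lu _] := zu k (inv k); apply: integ_dot => //; exact: vL2_mulmx.
pose EZ X k := Eon P X (fun w => dot (z k w) (z k w)).
pose EU X k := Eon P X (fun w => dot (u k w) (u k w)).
pose EQ X k := Eon P X (fun w => dot (u k w) (Delta *m u k w)).
pose S k := al k ^+ 2 + be k ^+ 2 / al k + be k ^+ 2.
have step k X : <<s G k >> X ->
  [/\ EZ X k.+1 <= (1 - c * al k) * EZ X k
        + C * S k * (Eon P X (cst 1) + (EZ X k + EU X k)),
      EU X k.+1 <= EU X k + c * al k * EZ X k
        + C * S k * (Eon P X (cst 1) + (EZ X k + EU X k)) &
      EQ X k.+1 <= (1 - c' * be k) * EQ X k + C * be k * EZ X k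
        + C * be k ^+ 2 * (Eon P X (cst 1) + (EZ X k + EU X k))].
  move=> sX; have [Lz mz Lu mu] := zu k (inv k); have [hN hN'] := noiseP k (inv k).
  exact: (hrec _ _ _ _ _ _ _ _ _ _ _ _ _ (GT k) (al_gt0 k) (be_gt0 k) Lz mz Lu mu hN hN'
    (zE' k) (uE k) sX).
have EZ0 X k : 0 <= EZ X k by apply: Eon_ge0 => w; exact: dot_ge0.
have EU0 X k : 0 <= EU X k by apply: Eon_ge0 => w; exact: dot_ge0.
have sT k : <<s G k >> setT by exact: (@measurableT _ (g_sigma_algebraType (G k))).
have pT : Eon P setT (cst 1) = 1 by rewrite Eon_cst // mul1r probability_setT.
have [D hD] : exists D, forall k, [/\ EZ setT k + EU setT k <= D,
    EZ setT k <= D * (k%:R + K1) `^ (- (1 / 2)) &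
    EQ setT k <= D * (k%:R + K1) `^ (- (1 / 2))].
  apply: (@two_timescale_rates R K1 eps alpha beta K1_ge1 eps0 eps4 alpha0 beta0
    (EZ setT) (EU setT) (EQ setT) c c' C) => // k; have := step k setT (sT k); rewrite pT.
  - by case.
  - by case.
  - by case.
have EQ0 X k : 0 <= EQ X k by apply: Eon_ge0.
have D0 : 0 <= D by have [h _ _] := hD 0%N; rewrite (le_trans _ h) // addr_ge0.
have n1 k : 1 <= k%:R + K1 by rewrite (le_trans K1_ge1) // lerDr.
(* One bound for both claims: r = 1/2 for the first, and the weaker r = 1/4 - eps for the second. *)
have rate r k : (0 < k)%N -> 0 <= r -> r <= 1 / 2 ->
    (k%:R + K1) `^ (- (1 / 2)) <= (k%:R `^ r)^-1.
  move=> k0 r0 r2; have k1 : 1 <= k%:R :> R by rewrite ler1n.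
  have k0' : 0 < k%:R :> R by rewrite ltr0n.
  rewrite powRN lef_pV2 ?posrE ?powR_gt0 //; last by rewrite (lt_le_trans ltr01).
  apply: (@le_trans _ _ (k%:R `^ (1 / 2))); first exact: ler_powR.
  apply: ge0_ler_powR; rewrite ?nnegrE ?divr_ge0 //; first by rewrite (le_trans ler01).
  by rewrite lerDl (le_trans ler01).
have [KD KD0 hKD] := psd_form_ge Dsym Dpsd.
have [M M0 hM] := step_errors K1_ge1 eps0 eps4 alpha0 beta0.
split; last first.
- have [KB KB0 hKB] := dot_mulmxD_bound A21 (1%:M : 'M[R]_d2).
  exists (KB * (D + KD * D)) => k k0.
  rewrite unlock; under eq_integral do rewrite enorm_sqr res.
  have [Lz mz Lu mu] := zu k (inv k).
  have Lr : vL2 P (fun w => A21 *m z k w + Delta *m u k w).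
    by apply: vL2D; exact: vL2_mulmx.
  rewrite EonE //; last exact: integ_dot.
  rewrite lee_fin; apply: (@le_trans _ _ (KB * (EZ setT k + KD * EQ setT k))).
    rewrite -EonZ // -EonD //; last exact: integZ.
    rewrite -EonZ //; last by apply: integD => //; exact: integZ.
    apply: Eon_le => //; first exact: integ_dot.
      by apply: integZ; apply: integD => //; exact: integZ.
    move=> w; have := hKB (z k w) (Delta *m u k w); rewrite mul1mx => h.
    by apply: (le_trans h); rewrite ler_pM2l // lerD2l.
  rewrite -mulrA ler_pM2l //; have [_ h1 h2] := hD k.
  have h3 := rate (1 / 4 - eps) k k0; have h2' := ler_wpM2l (ltW KD0) h2.
  apply: (@le_trans _ _ ((D + KD * D) * (k%:R + K1) `^ (- (1 / 2)))).
    rewrite mulrDl; move: h1 h2'; move: (_ `^ _) (EZ setT k) (EQ setT k) => p E Q h1 h2'.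
    clear -h1 h2'; lra.
  apply: ler_wpM2l; first by rewrite addr_ge0 // mulr_ge0 // ltW.
  by apply: h3; clear -eps0 eps4; lra.
- exists D => k k0.
  rewrite unlock; under eq_integral do rewrite enorm_sqr.
  rewrite EonE //; last exact: iZ.
  rewrite lee_fin; have [_ h1 _] := hD k; apply: (le_trans h1).
  by rewrite ler_wpM2l // rate // divr_ge0.
pose V k w := dot (z k w) (z k w) + dot (u k w) (Delta *m u k w).
have V0 k w : 0 <= V k w by rewrite addr_ge0 ?dot_ge0.
have iV k : integ P (V k) by exact: integD.
have mV k : submeas (G k) (V k).
  have [_ mz _ mu] := zu k (inv k).
  by apply: submeasD; apply: submeas_dot => //; exact: vsubmeas_mulmx.
(* [Kt'] adds up the bounds [t1], [t2] and [t3] below; the factor 4 / eps is that of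
   [powRN_telescope]. *)
pose Kt' := (2 * C * (1 + D) + C * D) * M; pose Kt := Kt' * (4 / eps).
have D1 : 0 <= 1 + D by rewrite addr_ge0.
have Kt0' : 0 <= Kt'.
  by apply: mulr_ge0; [apply: addr_ge0; apply: mulr_ge0 => //; exact: mulr_ge0|exact: ltW].
have Kt0 : 0 <= Kt by rewrite mulr_ge0 // divr_ge0 // ltW.
pose tau k := Kt * (k%:R + K1) `^ (- eps).
have tau0 k : 0 <= tau k by rewrite mulr_ge0 // powR_ge0.
(* The error terms over X are bounded by their values over the whole space, where the rates apply;
   the contraction terms are only used through their sign. *)
have hV k X : <<s G k >> X -> Eon P X (V k.+1) <= Eon P X (V k) + (tau k - tau k.+1).
  move=> sX; have mX := GT k X sX; have [h1 _ h3] := step k X sX.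
  rewrite /V EonD // EonD // -/(EZ X k.+1) -/(EQ X k.+1) -/(EZ X k) -/(EQ X k).
  have [hB hZ _] := hD k; have [m1 m2 m3] := hM k.
  have ZX : EZ X k <= EZ setT k by exact: (Eon_le_setT mX (iZ k) (fun w => dot_ge0 _)).
  have UX : EU X k <= EU setT k by exact: (Eon_le_setT mX (iU k) (fun w => dot_ge0 _)).
  have pX : Eon P X (cst 1) <= 1.
    by rewrite -[leRHS]pT; apply: (Eon_le_setT mX (integ_cst P 1)).
  have pX0 : 0 <= Eon P X (cst 1) by exact: Eon_ge0.
  set W := Eon P X (cst 1) + (EZ X k + EU X k) in h1 h3.
  have W0 : 0 <= W by rewrite /W !addr_ge0.
  have WD : W <= 1 + D by rewrite /W lerD // (le_trans _ hB) // lerD.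
  set n := k%:R + K1 in m1 m3 hZ.
  set s := n `^ (- (1 + eps)) in m1 m3.
  have tE : Kt' * s <= tau k - tau k.+1.
    rewrite /tau -mulrBr /Kt -[leRHS]mulrA ler_wpM2l //.
    have -> : k.+1%:R + K1 = n + 1 by rewrite -natr1 addrAC.
    by apply: powRN_telescope => //; [exact: n1|move: eps4; clear; lra].
  have bS : be k ^+ 2 <= S k.
    by rewrite lerDr addr_ge0 ?sqr_ge0 // divr_ge0 ?sqr_ge0 // ltW.
  have S0 : 0 <= S k by rewrite (le_trans _ bS) // sqr_ge0.
  have t1 : C * S k * W <= C * (M * s) * (1 + D).
    by apply: ler_pM => //; [exact: mulr_ge0|exact: ler_wpM2l].
  have t2 : C * be k ^+ 2 * W <= C * (M * s) * (1 + D).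
    apply: le_trans t1; apply: ler_wpM2r => //; exact: ler_wpM2l.
  have t3 : C * be k * EZ X k <= C * D * (M * s).
    apply: (@le_trans _ _ (C * D * (be k * n `^ (- (1 / 2))))).
      have -> : C * D * (be k * n `^ (- (1 / 2))) =
                C * be k * (D * n `^ (- (1 / 2))) by ring.
      apply: ler_wpM2l; first by rewrite mulr_ge0 // ltW.
      exact: le_trans ZX hZ.
    by apply: ler_wpM2l => //; exact: mulr_ge0.
  have t4 : 0 <= c * al k * EZ X k by rewrite mulr_ge0 // mulr_ge0 // ltW.
  have t5 : 0 <= c' * be k * EQ X k by rewrite mulr_ge0 // mulr_ge0 // ltW.
  clearbody W s; move: t1 t2 t3 t4 t5 h1 h3 tE; rewrite /Kt'.
  move: (tau k.+1) (tau k) (EZ X k.+1) (EQ X k.+1) (EZ X k) (EQ X k) (S k) (al k) (be k).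
  move=> t' t e' q' e q sk a b t1 t2 t3 t4 t5 h1 h3 tE.
  clear -t1 t2 t3 t4 t5 h1 h3 tE; lra.
have small e : 0 < e -> exists k, Eon P setT (V k) + tau k <= e.
  move=> e0; have K10 : 0 <= K1 by rewrite (le_trans ler01).
  have d1' : 0 < e / 2 / (1 + (D + D)) by rewrite !divr_gt0 // ltr_pwDl // addr_ge0.
  have d2' : 0 < e / 2 / (1 + Kt) by rewrite !divr_gt0 // ltr_pwDl.
  have h12 : 0 < 1 / 2 :> R by rewrite divr_gt0.
  have [k1 hk1] := powRN_eventually_le K10 h12 d1'.
  have [k2 hk2] := powRN_eventually_le K10 eps0 d2'.
  exists (maxn k1 k2); set k := maxn k1 k2.
  have [_ hZ hQ] := hD k; rewrite /V EonD // -/(EZ setT k) -/(EQ setT k) /tau.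
  have := hk1 k (leq_maxl _ _); have := hk2 k (leq_maxr _ _).
  rewrite !ler_pdivlMr ?ltr_pwDl ?addr_ge0 //.
  move: (powR_ge0 (k%:R + K1) (- (1 / 2))) (powR_ge0 (k%:R + K1) (- eps)) hZ hQ.
  move: (_ `^ _) (_ `^ _) (EZ setT k) (EQ setT k) => p r E Q p0 r0 hE hQ hr hp.
  clear -p0 r0 hE hQ hr hp; lra.
have := ae_cvg0 GT sGS mV iV V0 tau0 hV small.
apply: filterS => w Vw.
have [KB KB0 hKB] := mulmx_bound (B *m pinvmx Delta).
have [KP KP0 hKP] := mulmx_bound (pinvmx Delta).
(* With g = Delta u, the squared distance is at most |z - B Delta^+ g|^2 + |Delta^+ g|^2 <= 2 Z + (2
   KB + KP) |g|^2, and |g|^2 <= KD Q. *)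
pose K' := 2 + (2 * KB + KP) * KD.
apply: (@squeeze_cvgr _ _ _ _ (fun=> 0) (fun k => Num.sqrt (K' * V k w))).
- apply: nearW => k; apply/andP; split.
    apply: lb_le_inf; last by move=> _ [p _ <-]; exact: sqrtr_ge0.
    exists (Num.sqrt (enorm (x k w - xs) ^+ 2 + enorm (y k w - ys) ^+ 2)).
    by exists (xs, ys).
  (* [yc] moves [y k w] to [ys] plus an element of the kernel of [Delta]. *)
  pose g := Delta *m u k w; pose yc := y k w - pinvmx Delta *m g.
  have ycE : yc - ys = u k w - pinvmx Delta *m g by rewrite /yc /u addrAC.
  apply: (@le_trans _ _ (Num.sqrt (enorm (x k w - xstar yc) ^+ 2
    + enorm (y k w - yc) ^+ 2))).
    apply: ge_inf; first by exists 0 => _ [p _ <-]; exact: sqrtr_ge0.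
    exists (xstar yc, yc) => //; split => /=.
      by rewrite /xstar mulKVmx // subrK.
    by apply/eqP; rewrite -subr_eq0 resx ycE mulmx_near_kernel.
  apply: ler_wsqrtr; rewrite !enorm_sqr.
  have -> : y k w - yc = pinvmx Delta *m g by rewrite /yc opprB addrC subrK.
  have -> : x k w - xstar yc = z k w - (B *m pinvmx Delta) *m g.
    rewrite xstarE ycE zE /= mulmxBr (mulmxA B (pinvmx Delta)).
    move: (x k w) (B *m u k w) (B *m pinvmx Delta *m g) => v1 v2 v3.
    by apply/matrixP => i j; rewrite !mxE; ring.
  have h1 := dotD_le (z k w) (- ((B *m pinvmx Delta) *m g)).
  rewrite !(dotNl, dotNr) opprK in h1.
  have h2 := hKB g; have h3 := hKP g; have h4 := hKD (u k w); rewrite -/g in h4.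
  have Z0 := dot_ge0 (z k w); have Q0 := Dpsd (u k w).
  have h5 : (2 * KB + KP) * dot g g <= (2 * KB + KP) * (KD * dot (u k w) g).
    by rewrite ler_wpM2l // addr_ge0 ?mulr_ge0 // ltW.
  have h6 : 0 <= (2 * KB + KP) * KD.
    by rewrite mulr_ge0 ?addr_ge0 ?mulr_ge0 // ltW.
  have h7 := mulr_ge0 h6 Z0; rewrite /K' /V -/g.
  move: h1 h2 h3 h4 h5 h7 Z0 Q0; rewrite -/g.
  move: (dot (u k w) g) (dot (z k w) (z k w)) (dot g g)
    (dot (B *m pinvmx Delta *m g) (B *m pinvmx Delta *m g))
    (dot (pinvmx Delta *m g) (pinvmx Delta *m g)) (dot (z k w - _) _).
  move=> q Z G2 G3 G4 G5 h1 h2 h3 h4 h5 h7 Z0 Q0.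
  clear -h1 h2 h3 h4 h5 h7 Z0 Q0; lra.
- exact: cvg_cst.
have h : (fun k => K' * V k w) @ \oo --> (0 : R).
  by rewrite -(mulr0 K'); apply: cvgM => //; exact: cvg_cst.
by have := cvg_comp _ _ h (@sqrt_continuous R 0); rewrite sqrtr0.
Qed.
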